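(* Let $A$ be a completely contractive Banach algebra with a contractive right approximate identity. Then the completely contractive Banach algebra $(LUC(A^* )^*,\square)$ can be identified with the weak$^*$-closed operator subalgebra $CB_A(A^* )$ of $CB(A^* )$ via the weak$^*$-homeomorphic completely isometric algebra isomorphism $$CB_A(A^* )\to LUC(A^* )^*:\ T\mapsto\mu_T\quad\text{defined by}\quad\langle\mu_T,a^*\cdot a\rangle=\langle Ta^*,a\rangle\qquad(a^*\in A^*,\ a\in A).$$
   Context: A c.c. (completely contractive) Banach algebra is an associative algebra that is a (complete) operator space whose multiplication is jointly completely contractive: $\|[a_{ij}b_{kl}]\|_{M_{rs}(A)}\le\|[a_{ij}]\|_{M_r(A)}\|[b_{kl}]\|_{M_s(A)}$. A contractive right approximate identity is a net $(e_i)$ in the closed unit ball of $A$ with $ae_i\to a$ for all $a\in A$. $A^*$ is a right $A$-module via $\langle a^*\cdot a,b\rangle=\langle a^*,ab\rangle$. $LUC(A^* )$ is the closed linear span of $A^*\cdot A=\{a^*\cdot a\}$ in $A^*$, with the operator space structure inherited from $A^*$ (under the present hypothesis $LUC(A^* )=A^*\cdot A$). For $\mu\in LUC(A^* )^*$ and $\phi\in LUC(A^* )$, $\mu\,\square\,\phi\in LUC(A^* )$ is defined by $\langle\mu\,\square\,\phi,a\rangle=\langle\mu,\phi\cdot a\rangle$, and the product on $LUC(A^* )^*$ is $\langle\mu\,\square\,\nu,\phi\rangle=\langle\mu,\nu\,\square\,\phi\rangle$. $CB(A^* )$ is the algebra of completely bounded operators on $A^*$, with the weak$^*$-topology from $CB(A^*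 )=(A^*\widehat\otimes A)^*$, $\langle T,a^*\otimes a\rangle=\langle Ta^*,a\rangle$, where $\widehat\otimes$ is the operator space projective tensor product. $CB_A(A^* )=\{T\in CB(A^* ):T(a^*\cdot a)=T(a^* )\cdot a\text{ for all }a^*\in A^*,a\in A\}$. *)

(* Defs.v *)
From HB Require Import structures.
From mathcomp Require Import all_boot all_order all_algebra.
From mathcomp Require Import complex mxtens.
From mathcomp Require Import ring.
From mathcomp Require Import all_classical all_reals.
From mathcomp Require Import topology normedtype.

Set Implicit Arguments.
Unset Strict Implicit.
Unset Printing Implicit Defensive.
Import Order.TTheory GRing.Theory Num.Theory.
Import numFieldNormedType.Exports.
Import ComplexField.Normc.
Local Open Scope classical_set_scope.
Local Open Scope ring_scope.
Local Open Scope complex_scope.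

Section SupUnitBall.
Variables (R : realType) (I : Type) (N f : I -> R).

Definition sup_ball : R := sup [set r | exists2 i, N i <= 1 & r = f i].

Hypothesis fN : exists M, forall i, f i <= M * N i.
Hypothesis N0 : forall i, 0 <= N i.
Variable s : R -> I -> I.
Hypothesis Ns : forall c i, 0 <= c -> N (s c i) = c * N i.
Hypothesis fs : forall c i, 0 <= c -> f (s c i) = c * f i.

Let hasub : has_ubound [set r | exists2 i, N i <= 1 & r = f i].
Proof.
have [M hM] := fN; exists `|M| => _ [i Ni ->].
rewrite (le_trans (hM i))// (le_trans (ler_norm _))// normrM.
by rewrite (ger0_norm (N0 i)) ler_piMr.
Qed.

Lemma sup_ball_le i : f i <= sup_ball * N i.
Proof.
have [Ni0|Ni0] := eqVneq (N i) 0.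
  by have [M /(_ i)] := fN; rewrite Ni0 !mulr0.
have Nip : 0 < N i by rewrite lt_def Ni0 N0.
rewrite -ler_pdivrMr// mulrC -fs ?invr_ge0//.
apply: ub_le_sup => //; exists (s (N i)^-1 i) => //.
by rewrite Ns ?invr_ge0// mulVf.
Qed.

Lemma sup_ball_ub M : 0 <= M -> (forall i, f i <= M * N i) -> sup_ball <= M.
Proof.
move=> M0 h; have [[r rS]|] := pselect ([set r | exists2 i, N i <= 1 & r = f i] !=set0).
  apply: ge_sup; first by exists r.
  by move=> _ [i Ni ->]; rewrite (le_trans (h i))// ler_piMr.
by move=> /nonemptyPn; rewrite /sup_ball => ->; rewrite sup0.
Qed.

Lemma sup_ball_ge0 : (exists2 i, N i <= 1 & 0 <= f i) -> 0 <= sup_ball.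
Proof. by case=> i Ni fi; rewrite (le_trans fi)// ub_le_sup//; exists i. Qed.

End SupUnitBall.

Section ScalarMatrices.
Variable R : realType.
Notation C := R[i].

Lemma normCE (z : C) : `|z| = (normc z)%:C. Proof. by []. Qed.

Lemma normc_ge0 (z : C) : 0 <= normc z.
Proof. by rewrite -lecR -normCE; exact: normr_ge0. Qed.

Lemma normcD (x y : C) : normc (x + y) <= normc x + normc y.
Proof. by rewrite -lecR rmorphD -!normCE ler_normD. Qed.

Lemma normcR (x : R) : normc x%:C = `|x|.
Proof. by rewrite /= expr0n addr0 sqrtr_sqr. Qed.

Definition l2norm n (v : 'cV[C]_n) : R :=
  Num.sqrt (\sum_i normc (v i 0) ^+ 2).

(* Norm of a : C^n -> C^m for the Hilbert space norms; this is not the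
   entrywise maximum norm of the normedModType structure of 'M. *)
Definition opnorm m n (a : 'M[C]_(m, n)) : R :=
  sup [set r | exists2 v : 'cV[C]_n, l2norm v <= 1 & r = l2norm (a *m v)].

Lemma cauchy_schwarz (I : finType) (a b : I -> R) :
  \sum_i a i * b i <= Num.sqrt (\sum_i a i ^+ 2) * Num.sqrt (\sum_i b i ^+ 2).
Proof.
set A := \sum_i a i ^+ 2; set B := \sum_i b i ^+ 2; set S := \sum_i a i * b i.
have A0 : 0 <= A by apply: sumr_ge0 => i _; rewrite sqr_ge0.
have B0 : 0 <= B by apply: sumr_ge0 => i _; rewrite sqr_ge0.
rewrite -sqrtrM//; have [S0|S0] := leP S 0; first by rewrite (le_trans S0)// sqrtr_ge0.
rewrite -[leLHS](ger0_norm (ltW S0)) -sqrtr_sqr ler_wsqrtr//.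
have : 0 <= \sum_i (a i * B - b i * S) ^+ 2 by apply: sumr_ge0 => i _; rewrite sqr_ge0.
have -> : \sum_i (a i * B - b i * S) ^+ 2 = B * (A * B - S ^+ 2).
  under eq_bigr => i _.
    have -> : (a i * B - b i * S) ^+ 2 =
      a i ^+ 2 * B ^+ 2 - 2 * B * S * (a i * b i) + b i ^+ 2 * S ^+ 2.
      by rewrite sqrrB !exprMn mulr2n; ring.
    over.
  rewrite big_split/= sumrB -!mulr_suml -mulr_sumr -/A -/B -/S; ring.
have [B00|B00] := eqVneq B 0.
  suff : S = 0 by move=> S00; rewrite S00 ltxx in S0.
  rewrite /S big1// => i _.
  have /eqP := B00; rewrite /B psumr_eq0; last by move=> *; rewrite sqr_ge0.
  by move=> /allP/(_ i); rewrite mem_index_enum => /(_ isT)/=; rewrite sqrf_eq0 => /eqP->; rewrite mulr0.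
by rewrite pmulr_rge0 ?lt_def ?B00// subr_ge0.
Qed.

Lemma l2norm_ge0 n (v : 'cV[C]_n) : 0 <= l2norm v.
Proof. exact: sqrtr_ge0. Qed.

Lemma l2norm_sqr n (v : 'cV[C]_n) : l2norm v ^+ 2 = \sum_i normc (v i 0) ^+ 2.
Proof. by rewrite sqr_sqrtr// sumr_ge0// => i _; rewrite sqr_ge0. Qed.

Lemma l2norm_le n m (u : 'cV[C]_n) (v : 'cV[C]_m) (c : R) : 0 <= c ->
  \sum_i normc (u i 0) ^+ 2 <= c ^+ 2 * (\sum_i normc (v i 0) ^+ 2) ->
  l2norm u <= c * l2norm v.
Proof.
move=> c0; rewrite -!l2norm_sqr -exprMn ler_sqr// nnegrE ?l2norm_ge0//.
by rewrite mulr_ge0// l2norm_ge0.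
Qed.

Lemma l2norm_le1 n m (u : 'cV[C]_n) (v : 'cV[C]_m) :
  \sum_i normc (u i 0) ^+ 2 <= \sum_i normc (v i 0) ^+ 2 ->
  l2norm u <= l2norm v.
Proof. by move=> h; rewrite -[leRHS]mul1r l2norm_le// expr1n mul1r. Qed.

Lemma l2normD n (u v : 'cV[C]_n) : l2norm (u + v) <= l2norm u + l2norm v.
Proof.
have p : 0 <= l2norm u + l2norm v by rewrite addr_ge0 ?l2norm_ge0.
rewrite -ler_sqr ?nnegrE ?l2norm_ge0// l2norm_sqr sqrrD !l2norm_sqr.
apply: (@le_trans _ _ (\sum_i (normc (u i 0) + normc (v i 0)) ^+ 2)).
  apply: ler_sum => i _; rewrite !mxE ler_sqr ?nnegrE ?normcD ?normc_ge0//.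
  by rewrite addr_ge0 ?normc_ge0.
under eq_bigr do rewrite sqrrD.
rewrite !big_split/= lerD2r lerD2l mulr2n; apply: lerD;
exact: cauchy_schwarz.
Qed.

Lemma l2normZ n c (v : 'cV[C]_n) : l2norm (c *: v) = normc c * l2norm v.
Proof.
rewrite /l2norm; under eq_bigr do rewrite mxE normcM exprMn.
by rewrite -mulr_sumr sqrtrM ?sqr_ge0// sqrtr_sqr ger0_norm ?normc_ge0.
Qed.

Lemma l2norm0 n : l2norm (0 : 'cV[C]_n) = 0.
Proof. by rewrite -(scale0r 0) l2normZ normc0 mul0r. Qed.

Lemma l2norm_eq0 n (v : 'cV[C]_n) : l2norm v = 0 -> v = 0.
Proof.
move=> v0; apply/matrixP => i j; rewrite ord1 mxE; apply: eq0_normc.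
have := l2norm_sqr v; rewrite v0 expr0n/= => /esym/eqP.
rewrite psumr_eq0; last by move=> *; rewrite sqr_ge0.
by move=> /allP/(_ i); rewrite mem_index_enum => /(_ isT)/=; rewrite sqrf_eq0 => /eqP.
Qed.

Lemma l2norm_entry n (v : 'cV[C]_n) i : normc (v i 0) <= l2norm v.
Proof.
rewrite -ler_sqr ?nnegrE ?l2norm_ge0 ?normc_ge0// l2norm_sqr (bigD1 i)//=.
by rewrite lerDl sumr_ge0// => j _; rewrite sqr_ge0.
Qed.

Lemma l2norm_sum n (I : finType) (F : I -> 'cV[C]_n) :
  l2norm (\sum_i F i) <= \sum_i l2norm (F i).
Proof.
elim/big_ind2 : _ => //; first by rewrite l2norm0.
by move=> u a v b ua vb; rewrite (le_trans (l2normD _ _))// lerD.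
Qed.

Lemma l2norm_mul_bound m n (a : 'M[C]_(m, n)) :
  exists M, forall v, l2norm (a *m v) <= M * l2norm v.
Proof.
exists (\sum_j l2norm (col j a)) => v.
have -> : a *m v = \sum_j v j 0 *: col j a.
  apply/matrixP => i k; rewrite ord1 !mxE summxE; apply: eq_bigr => j _.
  by rewrite !mxE mulrC.
rewrite (le_trans (l2norm_sum _))// mulr_suml ler_sum// => j _.
by rewrite l2normZ mulrC ler_wpM2l ?l2norm_ge0// l2norm_entry.
Qed.

Lemma opnorm_sup m n (a : 'M[C]_(m, n)) :
  opnorm a = sup_ball (@l2norm n) (fun v => l2norm (a *m v)).
Proof. by []. Qed.

Lemma opnormP m n (a : 'M[C]_(m, n)) v : l2norm (a *m v) <= opnorm a * l2norm v.
Proof.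
rewrite opnorm_sup.
apply: (@sup_ball_le _ _ _ (fun v => l2norm (a *m v)) _ _ (fun c v => c%:C *: v)).
- exact: l2norm_mul_bound.
- exact: l2norm_ge0.
- by move=> c w c0; rewrite l2normZ normcR ger0_norm.
- by move=> c w c0; rewrite -scalemxAr l2normZ normcR ger0_norm.
Qed.

Lemma opnorm_le m n (a : 'M[C]_(m, n)) M : 0 <= M ->
  (forall v, l2norm (a *m v) <= M * l2norm v) -> opnorm a <= M.
Proof. exact: sup_ball_ub. Qed.

Lemma opnorm_ge0 m n (a : 'M[C]_(m, n)) : 0 <= opnorm a.
Proof.
apply: sup_ball_ge0; first exact: l2norm_mul_bound.
  exact: l2norm_ge0.
by exists 0; rewrite ?l2norm_ge0// l2norm0.
Qed.

Lemma opnormD m n (a b : 'M[C]_(m, n)) : opnorm (a + b) <= opnorm a + opnorm b.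
Proof.
apply: opnorm_le => [|v]; first by rewrite addr_ge0 ?opnorm_ge0.
by rewrite mulmxDl (le_trans (l2normD _ _))// mulrDl lerD// opnormP.
Qed.

Lemma opnormZ_le m n c (a : 'M[C]_(m, n)) : opnorm (c *: a) <= normc c * opnorm a.
Proof.
apply: opnorm_le => [|v]; first by rewrite mulr_ge0 ?normc_ge0 ?opnorm_ge0.
by rewrite -scalemxAl l2normZ -mulrA ler_wpM2l ?normc_ge0// opnormP.
Qed.

Lemma opnorm_eq0 m n (a : 'M[C]_(m, n)) : opnorm a = 0 -> a = 0.
Proof.
move=> a0; apply/matrixP => i j; rewrite mxE.
have : l2norm (a *m delta_mx j 0) = 0.
  apply/eqP; rewrite eq_le l2norm_ge0 andbT (le_trans (opnormP _ _))//.
  by rewrite a0 mul0r.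
by move=> /l2norm_eq0; rewrite -colE => /matrixP/(_ i 0); rewrite !mxE.
Qed.

Lemma opnormM m n p (a : 'M[C]_(m, n)) (b : 'M[C]_(n, p)) :
  opnorm (a *m b) <= opnorm a * opnorm b.
Proof.
apply: opnorm_le => [|v]; first by rewrite mulr_ge0 ?opnorm_ge0.
rewrite -mulmxA (le_trans (opnormP _ _))// -mulrA ler_wpM2l ?opnorm_ge0//.
exact: opnormP.
Qed.

Lemma opnorm_cast m n m' n' (e : (m = m') * (n = n')) (a : 'M[C]_(m, n)) :
  opnorm (castmx e a) = opnorm a.
Proof. by case: e => e1 e2; case: m' / e1; case: n' / e2. Qed.

Lemma l2norm_col_mx m n (u : 'cV[C]_m) (v : 'cV[C]_n) :
  l2norm (col_mx u v) ^+ 2 = l2norm u ^+ 2 + l2norm v ^+ 2.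
Proof.
rewrite !l2norm_sqr big_split_ord/=; congr (_ + _); apply: eq_bigr => i _.
  by rewrite col_mxEu.
by rewrite col_mxEd.
Qed.

Lemma opnorm_block m n p q (a : 'M[C]_(m, n)) (b : 'M[C]_(p, q)) :
  opnorm (block_mx a 0 0 b) <= Num.max (opnorm a) (opnorm b).
Proof.
set M := Num.max _ _.
have M0 : 0 <= M by rewrite le_max opnorm_ge0.
apply: opnorm_le => // v; rewrite -[v]vsubmxK mul_block_col !mul0mx addr0 add0r.
apply: l2norm_le => //; rewrite -!l2norm_sqr !l2norm_col_mx mulrDr.
have h r s (c : 'M[C]_(r, s)) w : opnorm c <= M ->
    l2norm (c *m w) ^+ 2 <= M ^+ 2 * l2norm w ^+ 2.
  move=> cM; rewrite -exprMn ler_sqr ?nnegrE ?mulr_ge0 ?l2norm_ge0//.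
  by rewrite (le_trans (opnormP _ _))// ler_wpM2r ?l2norm_ge0.
by rewrite lerD// h// /M le_max lexx ?orbT.
Qed.

Lemma opnorm_inj m n (f : 'I_m -> 'I_n) : injective f ->
  opnorm (\matrix_(i, j) ((f j == i)%:R : C)) <= 1.
Proof.
move=> injf; apply: opnorm_le => // v; rewrite mul1r l2norm_le1//.
under eq_bigr => i _.
  have -> : normc (((\matrix_(i, j) ((f j == i)%:R : C)) *m v) i 0) ^+ 2 =
            \sum_(j | f j == i) normc (v j 0) ^+ 2.
    rewrite mxE; under eq_bigr do rewrite mxE.
    have -> : \sum_j (f j == i)%:R * v j 0 = \sum_(j | f j == i) v j 0.
      by rewrite [RHS]big_mkcond/=; apply: eq_bigr => j _; case: eqP; rewrite ?mul1r ?mul0r.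
    case: (pickP (fun j => f j == i)) => [j /eqP <-|f0].
      by under eq_bigl do rewrite (inj_eq injf); under [RHS]eq_bigl do rewrite (inj_eq injf); rewrite !big_pred1_eq.
    by rewrite !big_pred0// normc0 expr0n.
  over.
rewrite (exchange_big_dep predT)//=; apply: ler_sum => j _.
by under eq_bigl do rewrite eq_sym; rewrite big_pred1_eq.
Qed.

Lemma opnorm_injT m n (f : 'I_m -> 'I_n) : injective f ->
  opnorm (\matrix_(i, j) ((f i == j)%:R : C)) <= 1.
Proof.
move=> injf; apply: opnorm_le => // v; rewrite mul1r l2norm_le1//.
under eq_bigr => i _.
  have -> : ((\matrix_(i, j) ((f i == j)%:R : C)) *m v) i 0 = v (f i) 0.
    rewrite mxE (bigD1 (f i))//= mxE eqxx mul1r big1 ?addr0// => j ji.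
    by rewrite mxE eq_sym (negbTE ji) mul0r.
  over.
have := big_imset (fun j => normc (v j 0) ^+ 2) (in2W injf : {in 'I_m &, injective f}).
move=> /= <-; rewrite [leRHS](bigID (mem (f @: 'I_m)%SET))/= lerDl.
by apply: sumr_ge0 => *; rewrite sqr_ge0.
Qed.

Lemma opnorm_tens1 m n k (a : 'M[C]_(m, n)) :
  opnorm (a *t (1%:M : 'M[C]_k)) <= opnorm a.
Proof.
apply: opnorm_le => [|v]; first exact: opnorm_ge0.
apply: l2norm_le; first exact: opnorm_ge0.
pose w (j : 'I_k) : 'cV[C]_n := \col_i v (mxtens_index (i, j)) 0.
have re r (g : 'I_(r * k) -> R) : \sum_i g i = \sum_(j < k) \sum_(i < r) g (mxtens_index (i, j)).
  rewrite exchange_big pair_big/= (reindex (@mxtens_index r k))/=.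
    by apply: eq_bigr => -[].
  by exists (@mxtens_unindex r k) => i _; rewrite (mxtens_indexK, mxtens_unindexK).
rewrite !re mulr_sumr ler_sum// => j _.
have : l2norm (a *m w j) ^+ 2 <= (opnorm a * l2norm (w j)) ^+ 2.
  by rewrite ler_sqr ?nnegrE ?mulr_ge0 ?l2norm_ge0 ?opnorm_ge0// opnormP.
rewrite exprMn !l2norm_sqr; congr (_ <= _); last first.
  by congr (_ * _); apply: eq_bigr => i _; rewrite mxE.
apply: eq_bigr => i _; congr (normc _ ^+ 2); rewrite !mxE.
rewrite (reindex (@mxtens_index n k))/=; last first.
  by exists (@mxtens_unindex n k) => l _; rewrite (mxtens_indexK, mxtens_unindexK).
rewrite (eq_bigr (fun p => a i p.1 * (j == p.2)%:R * v (mxtens_index (p.1, p.2)) 0)); last first.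
  by move=> [p q] _; rewrite tensmxE mxE.
rewrite -(pair_bigA _ (fun p q => a i p * (j == q)%:R * v (mxtens_index (p, q)) 0))/=.
apply: eq_bigr => p _; rewrite mxE (bigD1 j)//= eqxx mulr1 big1 ?addr0// => q qj.
by rewrite eq_sym (negbTE qj) mulr0 mul0r.
Qed.

Lemma opnorm_col n (v : 'cV[C]_n) : opnorm v <= l2norm v.
Proof.
apply: opnorm_le => [|w]; first exact: l2norm_ge0.
have -> : v *m w = w 0 0 *: v.
  by apply/matrixP => i j; rewrite ord1 !mxE big_ord1 mulrC.
by rewrite l2normZ mulrC ler_wpM2l ?l2norm_ge0// l2norm_entry.
Qed.

Lemma opnorm_row n (v : 'cV[C]_n) :
  opnorm (\row_i (v i 0)^*%C) <= l2norm v.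
Proof.
apply: opnorm_le => [|w]; first exact: l2norm_ge0.
rewrite /l2norm big_ord1 sqrtr_sqr ger0_norm ?normc_ge0//.
apply: le_trans (cauchy_schwarz _ _).
rewrite mxE; under eq_bigr do rewrite mxE.
elim/big_ind2 : _ => [|x a y b xa yb|i _]; first by rewrite normc0.
  by rewrite (le_trans (normcD _ _))// lerD.
by rewrite normcM -lecR !rmorphM/= -!normCE normcJ.
Qed.

End ScalarMatrices.

(* The product a x b of Ruan's axioms: scalar matrices acting on M_m(V). *)
Definition mxact (R : realType) (V : lmodType R[i]) m n
    (a : 'M[R[i]]_(n, m)) (x : 'M[V]_m) (b : 'M[R[i]]_(m, n)) : 'M[V]_n :=
  \matrix_(i, j) \sum_k \sum_l (a i k * b l j) *: x k l.

(* [f(x_ij, y_kl)] in M_mn, with rows indexed by (i, k) and columns by (j, l). *)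
Definition mxkron (U V W : Type) (f : U -> V -> W) m n
    (x : 'M[U]_m) (y : 'M[V]_n) : 'M[W]_(m * n) :=
  \matrix_(p, q) f (x (mxtens_unindex p).1 (mxtens_unindex q).1)
                   (y (mxtens_unindex p).2 (mxtens_unindex q).2).

(* An operator space in Ruan's abstract sense, with matrix norms valued in R;
   the norm of V is that of M_1(V). Scaling by c is written entrywise since
   'M[V]_n has no lmodType structure when V is only a module. *)
HB.mixin Record NormedModule_isOperatorSpace (R : realType) V
    & NormedModule R[i] V := {
  mxnorm : forall n, 'M[V]_n -> R ;
  mxnorm_normr : forall x : V, (mxnorm _ (const_mx x : 'M_1))%:C = `|x| ;
  ler_mxnormD : forall n (x y : 'M[V]_n),
    mxnorm _ (x + y) <= mxnorm _ x + mxnorm _ y ;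
  mxnormZ : forall n (c : R[i]) (x : 'M[V]_n),
    mxnorm _ (map_mx ( *:%R c) x) = normc c * mxnorm _ x ;
  mxnorm0_eq0 : forall n (x : 'M[V]_n), mxnorm _ x = 0 -> x = 0 ;
  mxnorm_dsum : forall m n (x : 'M[V]_m) (y : 'M[V]_n),
    mxnorm _ (block_mx x 0 0 y) = Num.max (mxnorm _ x) (mxnorm _ y) ;
  mxnorm_act : forall m n (a : 'M[R[i]]_(n, m)) (x : 'M[V]_m)
      (b : 'M[R[i]]_(m, n)),
    mxnorm _ (mxact a x b) <= opnorm a * mxnorm _ x * opnorm b }.

#[short(type="operatorSpaceType")]
HB.structure Definition OperatorSpace (R : realType) :=
  {V of NormedModule R[i] V & NormedModule_isOperatorSpace R V}.

Arguments mxnorm {R s n} _.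
Arguments ler_mxnormD {R s n}.
Arguments mxnormZ {R s n}.
Arguments mxnorm0_eq0 {R s n}.
Arguments mxnorm_dsum {R s m n}.
Arguments mxnorm_act {R s m n}.

(* Ruan's axioms restricted to the matrices with entries in P, with the
   inequalities that imply the equalities of the mixin. *)
Record ruan_norms (R : realType) (V : lmodType R[i]) (P : V -> Prop)
    (N : forall n, 'M[V]_n -> R) : Prop := RuanNorms {
  ruanD : forall n (x y : 'M[V]_n), (forall i j, P (x i j)) ->
    (forall i j, P (y i j)) -> N n (x + y) <= N n x + N n y ;
  ruanZ : forall n c (x : 'M[V]_n), (forall i j, P (x i j)) ->
    N n (map_mx ( *:%R c) x) <= normc c * N n x ;
  ruan0 : forall n (x : 'M[V]_n), (forall i j, P (x i j)) ->
    N n x = 0 -> x = 0 ;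
  ruan_dsum : forall m n (x : 'M[V]_m) (y : 'M[V]_n),
    (forall i j, P (x i j)) -> (forall i j, P (y i j)) ->
    N (m + n)%N (block_mx x 0 0 y) <= Num.max (N m x) (N n y) ;
  ruan_act : forall m n (a : 'M[R[i]]_(n, m)) (x : 'M[V]_m)
      (b : 'M[R[i]]_(m, n)), (forall i j, P (x i j)) ->
    N n (mxact a x b) <= opnorm a * N m x * opnorm b }.

Lemma mxact_map (R : realType) (V W : lmodType R[i]) (j : {linear V -> W}) m n
    (a : 'M[R[i]]_(n, m)) (x : 'M[V]_m) (b : 'M[R[i]]_(m, n)) :
  map_mx j (mxact a x b) = mxact a (map_mx j x) b.
Proof.
apply/matrixP => p q; rewrite !mxE linear_sum/=.
apply: eq_bigr => k _; rewrite linear_sum/=; apply: eq_bigr => l _.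
by rewrite linearZ/= mxE.
Qed.

Lemma ruan_pullback (R : realType) (V W : lmodType R[i]) (j : {linear V -> W})
    (P : W -> Prop) (N : forall n, 'M[W]_n -> R) :
  injective j -> (forall x, P (j x)) -> ruan_norms P N ->
  ruan_norms (fun=> True) (fun n (x : 'M[V]_n) => N n (map_mx j x)).
Proof.
move=> injj Pj [D Z z S A].
have P' n (x : 'M[V]_n) i k : P (map_mx j x i k) by rewrite mxE.
have j0 : j 0 = 0 by exact: linear0.
split=> [n x y _ _|n c x _|n x _|m n x y _ _|m n a x b _].
- have -> : map_mx j (x + y) = map_mx j x + map_mx j y.
    by apply/matrixP => p q; rewrite !mxE linearD.
  exact: D.
- have -> : map_mx j (map_mx ( *:%R c) x) = map_mx ( *:%R c) (map_mx j x).
    by apply/matrixP => p q; rewrite !mxE linearZ.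
  exact: Z.
- move=> /z-/(_ (P' _ _))/matrixP h; apply/matrixP => p q; apply: injj.
  by have := h p q; rewrite !mxE j0.
- rewrite map_block_mx.
  have h0 r s : map_mx j (0 : 'M[V]_(r, s)) = 0.
    by apply/matrixP => p q; rewrite !mxE j0.
  by rewrite !h0; apply: S.
- by rewrite mxact_map; apply: A.
Qed.

HB.factory Record Lmodule_isOperatorSpace (R : realType) V
    & GRing.Lmodule R[i] V := {
  mxnorm : forall n, 'M[V]_n -> R ;
  mxnorm_ruan : ruan_norms (fun=> True) mxnorm }.

HB.builders Context R V & Lmodule_isOperatorSpace R V.

Let D n (x y : 'M[V]_n) : mxnorm (x + y) <= mxnorm x + mxnorm y.
Proof. exact: (ruanD mxnorm_ruan). Qed.

Let Z n c (x : 'M[V]_n) : mxnorm (map_mx ( *:%R c) x) = normc c * mxnorm x.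
Proof.
apply/eqP; rewrite eq_le (ruanZ mxnorm_ruan)//=.
have [->|c0] := eqVneq c 0.
  rewrite normc0 mul0r.
  have x0 : map_mx ( *:%R 0) x = 0 :> 'M[V]_n.
    by apply/matrixP => i j; rewrite !mxE scale0r.
  have := @D n 0 0; rewrite addr0 -{1}[mxnorm 0]addr0 lerD2l.
  by rewrite x0.
have nc : 0 < normc c.
  by rewrite lt_def normc_ge0 andbT; apply: contra_neq c0 => /eq0_normc.
rewrite -ler_pdivlMl// -normcV.
have {1}-> : x = map_mx ( *:%R c^-1) (map_mx ( *:%R c) x).
  by apply/matrixP => i j; rewrite !mxE scalerA mulVf// scale1r.
exact: (ruanZ mxnorm_ruan).
Qed.

Let z n : mxnorm (0 : 'M[V]_n) = 0.
Proof.
have -> : 0 = map_mx ( *:%R 0) 0 :> 'M[V]_n.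
  by apply/matrixP => i j; rewrite !mxE scale0r.
by rewrite Z normc0 mul0r.
Qed.

Let ge0 n (x : 'M[V]_n) : 0 <= mxnorm x.
Proof.
have := D x (map_mx ( *:%R (-1)) x).
have -> : x + map_mx ( *:%R (-1)) x = 0.
  by apply/matrixP => i j; rewrite !mxE scaleN1r subrr.
rewrite z Z -[normc (-1)]/(Num.sqrt _)/= oppr0 expr0n addr0 sqrrN expr1n sqrtr1.
by rewrite mul1r -mulr2n pmulrn_lge0.
Qed.

Let nrm (x : V) : R[i] := (mxnorm (const_mx x : 'M_1))%:C.

Let nrmD x y : nrm (x + y) <= nrm x + nrm y.
Proof.
rewrite /nrm -rmorphD/= lecR (le_trans _ (D _ _))// le_eqVlt; apply/orP; left.
by apply/eqP; congr mxnorm; apply/matrixP => i j; rewrite !mxE.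
Qed.

Let nrmZ c x : nrm (c *: x) = `|c| * nrm x.
Proof.
rewrite /nrm normCE -rmorphM/= -Z; congr (mxnorm _)%:C.
by apply/matrixP => i j; rewrite !mxE.
Qed.

Let nrm0 x : nrm x = 0 -> x = 0.
Proof.
move=> [] /(ruan0 mxnorm_ruan (fun _ _ => I))/matrixP/(_ 0 0).
by rewrite !mxE.
Qed.

HB.instance Definition _ := Lmodule_isNormed.Build R[i] V nrmD nrmZ nrm0.

Let nrmE (x : V) : (mxnorm (const_mx x : 'M_1))%:C = `|x|.
Proof. by []. Qed.

Let dsum m n (x : 'M[V]_m) (y : 'M[V]_n) :
  mxnorm (block_mx x 0 0 y) = Num.max (mxnorm x) (mxnorm y).
Proof.
apply/eqP; rewrite eq_le (ruan_dsum mxnorm_ruan)//= ge_max.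
have cmp (k : nat) (f : 'I_k -> 'I_(m + n)) (w : 'M[V]_k) : injective f ->
    (forall i j, block_mx x 0 0 y (f i) (f j) = w i j) ->
    mxnorm w <= mxnorm (block_mx x 0 0 y).
  move=> fi fw.
  have -> : w = mxact (\matrix_(i, j) (f i == j)%:R) (block_mx x 0 0 y)
                      (\matrix_(i, j) (f j == i)%:R).
    apply/matrixP => i j; rewrite mxE (bigD1 (f i))//= [X in _ + X]big1 ?addr0.
      rewrite (bigD1 (f j))//= [X in _ + X]big1 ?addr0.
        by rewrite fw mxE mxE !eqxx mulr1 scale1r.
      by move=> l /negbTE lj; rewrite [X in _ * X]mxE [f j == _]eq_sym lj mulr0 scale0r.
    move=> k' /negbTE ki; rewrite big1// => l _.
    by rewrite [X in X * _]mxE [f i == _]eq_sym ki mul0r scale0r.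
  rewrite (le_trans (ruan_act mxnorm_ruan _ _ (fun _ _ => I)))//.
  rewrite -[leRHS]mulr1 ler_pM ?mulr_ge0 ?opnorm_ge0 ?ge0 ?opnorm_inj//.
  by rewrite -[leRHS]mul1r ler_wpM2r ?ge0// opnorm_injT.
by rewrite (cmp _ (lshift n)) ?(cmp _ (@rshift m n))//;
  [exact: rshift_inj|move=> *; rewrite block_mxEdr|exact: lshift_inj
  |move=> *; rewrite block_mxEul].
Qed.

Let ract m n (a : 'M[R[i]]_(n, m)) (x : 'M[V]_m) (b : 'M[R[i]]_(m, n)) :
  mxnorm (mxact a x b) <= opnorm a * mxnorm x * opnorm b.
Proof. exact: (ruan_act mxnorm_ruan). Qed.

HB.instance Definition _ := NormedModule_isOperatorSpace.Build R V
  nrmE D Z (fun n x => @ruan0 _ _ _ _ mxnorm_ruan n x (fun _ _ => I)) dsum ract.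

HB.end.

Section ScalarOperatorSpace.
Variable R : realType.
Notation C := R[i].

Let scal_normr (x : C^o) : (opnorm (const_mx x : 'M[C]_1))%:C = `|x|.
Proof.
rewrite normCE; congr (_%:C); apply/eqP; rewrite eq_le; apply/andP; split.
  apply: opnorm_le => [|v]; first exact: normc_ge0.
  have -> : const_mx x *m v = x *: v.
    by apply/matrixP => i j; rewrite !mxE big_ord1 !mxE !ord1.
  by rewrite l2normZ.
have l1 (z : C) : l2norm (const_mx z : 'cV[C]_1) = normc z.
  by rewrite /l2norm big_ord1 mxE sqrtr_sqr ger0_norm ?normc_ge0.
have := opnormP (const_mx x : 'M[C]_1) (const_mx 1).
have -> : (const_mx x : 'M[C]_1) *m const_mx 1 = const_mx x :> 'cV[C]_1.
  by apply/matrixP => i j; rewrite !mxE big_ord1 !mxE mulr1.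
by rewrite !l1 normc1 mulr1.
Qed.

Let scalZ n (c : C) (x : 'M[C^o]_n) :
  opnorm (map_mx ( *:%R c) x) = normc c * opnorm x.
Proof.
have sE (d : C) (y : 'M[C^o]_n) : map_mx ( *:%R d) y = d *: (y : 'M[C]_n).
  by apply/(@matrixP C) => i j; rewrite !mxE.
rewrite sE; apply/eqP; rewrite eq_le opnormZ_le/=.
have [->|c0] := eqVneq c 0; first by rewrite normc0 mul0r opnorm_ge0.
have nc : 0 < normc c.
  by rewrite lt_def normc_ge0 andbT; apply: contra_neq c0 => /eq0_normc.
rewrite -ler_pdivlMl// -normcV (le_trans _ (opnormZ_le _ _))//.
by rewrite scalerA mulVf// scale1r.
Qed.

Let scal_act m n (a : 'M[C]_(n, m)) (x : 'M[C^o]_m) (b : 'M[C]_(m, n)) :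
  opnorm (mxact a x b) <= opnorm a * opnorm x * opnorm b.
Proof.
have -> : mxact a x b = a *m (x : 'M[C]_m) *m b.
  apply/matrixP => i j; rewrite !mxE exchange_big/=; apply: eq_bigr => l _.
  rewrite mxE mulr_suml; apply: eq_bigr => k _.
  by rewrite -[LHS]/(a i k * b l j * x k l) mulrAC.
by rewrite (le_trans (opnormM _ _))// ler_wpM2r ?opnorm_ge0// opnormM.
Qed.

Let scal_dsum m n (x : 'M[C^o]_m) (y : 'M[C^o]_n) :
  opnorm (block_mx x 0 0 y : 'M[C]_(m + n)) = Num.max (opnorm x) (opnorm y).
Proof.
apply/eqP; rewrite eq_le opnorm_block/= ge_max; apply/andP; split.
  apply: opnorm_le => [|v]; first exact: opnorm_ge0.
  have := opnormP (block_mx x 0 0 y : 'M[C]_(m + n)) (col_mx v 0).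
  rewrite mul_block_col !mulmx0 !mul0mx !addr0.
  have l0 k (u : 'cV[C]_k) q : l2norm (col_mx u (0 : 'cV_q)) = l2norm u.
    by apply/eqP; rewrite -(@eqrXn2 _ 2) ?l2norm_ge0// l2norm_col_mx l2norm0 expr0n addr0.
  by rewrite !l0.
apply: opnorm_le => [|v]; first exact: opnorm_ge0.
have := opnormP (block_mx x 0 0 y : 'M[C]_(m + n)) (col_mx 0 v).
rewrite mul_block_col !mulmx0 !mul0mx !add0r.
have l0 k (u : 'cV[C]_k) q : l2norm (col_mx (0 : 'cV_q) u) = l2norm u.
  by apply/eqP; rewrite -(@eqrXn2 _ 2) ?l2norm_ge0// l2norm_col_mx l2norm0 expr0n add0r.
by rewrite !l0.
Qed.

HB.instance Definition _ := NormedModule_isOperatorSpace.Build R C^o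
  scal_normr (fun n => @opnormD R n n) scalZ (fun n => @opnorm_eq0 R n n)
  scal_dsum scal_act.

End ScalarOperatorSpace.

Section OperatorSpaceTheory.
Variables (R : realType) (V : operatorSpaceType R).
Implicit Types x y : V.

Definition vnorm x : R := mxnorm (const_mx x : 'M_1).

Lemma vnormE x : `|x| = (vnorm x)%:C.
Proof. by rewrite -mxnorm_normr. Qed.

Lemma mxnormE1 (x : 'M[V]_1) : mxnorm x = vnorm (x 0 0).
Proof.
by congr mxnorm; apply/matrixP => i j; rewrite !ord1 mxE.
Qed.

Lemma mxnorm0 n : mxnorm (0 : 'M[V]_n) = 0.
Proof.
have -> : 0 = map_mx ( *:%R 0) 0 :> 'M[V]_n.
  by apply/matrixP => i j; rewrite !mxE scale0r.
by rewrite mxnormZ normc0 mul0r.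
Qed.

Lemma mxnorm_ge0 n (x : 'M[V]_n) : 0 <= mxnorm x.
Proof.
have := ler_mxnormD x (map_mx ( *:%R (-1)) x).
have -> : x + map_mx ( *:%R (-1)) x = 0.
  by apply/matrixP => i j; rewrite !mxE scaleN1r subrr.
rewrite mxnorm0 mxnormZ -[normc (-1)]/(Num.sqrt _)/= oppr0 expr0n addr0 sqrrN.
by rewrite expr1n sqrtr1 mul1r -mulr2n pmulrn_lge0.
Qed.

Lemma mxnorm_sum (I : finType) n (F : I -> 'M[V]_n) :
  mxnorm (\sum_i F i) <= \sum_i mxnorm (F i).
Proof.
elim/big_ind2 : _ => //; first by rewrite mxnorm0.
by move=> u a v b ua vb; rewrite (le_trans (ler_mxnormD _ _))// lerD.
Qed.

Lemma mxnorm_cast m n (e : (m = n) * (m = n)) (x : 'M[V]_m) :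
  mxnorm (castmx e x) = mxnorm x.
Proof.
case: e => e1 e2; case: n / e1 e2 => e2.
by rewrite (eq_irrelevance e2 erefl).
Qed.

End OperatorSpaceTheory.

Section CompletelyBounded.
Variables (R : realType) (V W : operatorSpaceType R).
Notation C := R[i].

Definition completely_bounded (f : V -> W) : Prop :=
  exists M : R, forall n (x : 'M[V]_n), mxnorm (map_mx f x) <= M * mxnorm x.

(* Norm of M_n(CB(V, W)) = CB(V, M_n(W)), for a matrix of completely bounded
   linear maps. *)
Definition cbnorm n (F : 'M[V -> W]_n) : R :=
  sup [set r | exists2 x : {m : nat & 'M[V]_m}, mxnorm (projT2 x) <= 1 &
                 r = mxnorm (mxkron (fun f v => f v) F (projT2 x))].

Local Notation app := (mxkron (fun f v => f v)).

Lemma lincb_bound n (F : 'M[V -> W]_n) : (forall i j, completely_bounded (F i j)) ->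
  exists M, forall m (x : 'M[V]_m), mxnorm (app F x) <= M * mxnorm x.
Proof.
move=> Fcb; pose M i j := sval (cid (Fcb i j)).
have MP i j m (x : 'M[V]_m) : mxnorm (map_mx (F i j) x) <= M i j * mxnorm x.
  exact: (svalP (cid (Fcb i j))).
exists (\sum_i \sum_j `|M i j|) => m x.
pose A (i : 'I_n) : 'M[C]_(n * m, m) :=
  \matrix_(p, k) (mxtens_index (i, k) == p)%:R.
pose B (i : 'I_n) : 'M[C]_(m, n * m) :=
  \matrix_(k, p) (mxtens_index (i, k) == p)%:R.
have inji i : injective (fun k : 'I_m => mxtens_index (i : 'I_n, k)).
  by move=> k l /(can_inj (@mxtens_indexK _ _))[].
have -> : app F x = \sum_i \sum_j mxact (A i) (map_mx (F i j) x) (B j).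
  apply/matrixP => p q; case: (mxtens_indexP p) => i k; case: (mxtens_indexP q) => j l.
  rewrite !mxE !mxtens_indexK/= summxE (bigD1 i)//= summxE (bigD1 j)//=.
  rewrite [X in _ + X + _]big1 ?addr0; last first.
    move=> j' /negbTE j'j; rewrite mxE big1// => k' _; rewrite big1// => l' _.
    rewrite [X in _ * X]mxE (inj_eq (can_inj (@mxtens_indexK _ _))) xpair_eqE.
    by rewrite j'j mulr0 scale0r.
  rewrite [X in _ + X]big1 ?addr0; last first.
    move=> i' /negbTE i'i; rewrite summxE big1// => j' _.
    rewrite mxE big1// => k' _; rewrite big1// => l' _.
    rewrite [X in X * _]mxE (inj_eq (can_inj (@mxtens_indexK _ _))) xpair_eqE.
    by rewrite i'i mul0r scale0r.
  rewrite mxE (bigD1 k)//= (bigD1 l)//= !mxE !eqxx mulr1 scale1r.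
  rewrite [X in _ + X + _]big1 ?addr0; last first.
    move=> l' /negbTE l'l; rewrite [X in _ * X]mxE.
    by rewrite (inj_eq (can_inj (@mxtens_indexK _ _))) xpair_eqE l'l andbF mulr0 scale0r.
  rewrite big1 ?addr0// => k' /negbTE k'k; rewrite big1// => l' _.
  rewrite [X in X * _]mxE.
  by rewrite (inj_eq (can_inj (@mxtens_indexK _ _))) xpair_eqE k'k andbF mul0r scale0r.
rewrite (le_trans (mxnorm_sum _))// mulr_suml ler_sum// => i _.
rewrite (le_trans (mxnorm_sum _))// mulr_suml ler_sum// => j _.
rewrite (le_trans (mxnorm_act _ _ _))//.
rewrite (@le_trans _ _ (mxnorm (map_mx (F i j) x)))//; last first.
  by rewrite (le_trans (MP i j m x))// ler_wpM2r ?mxnorm_ge0 ?ler_norm.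
rewrite -[leRHS]mulr1 ler_pM ?mulr_ge0 ?opnorm_ge0 ?mxnorm_ge0 ?opnorm_injT//.
by rewrite -[leRHS]mul1r ler_wpM2r ?mxnorm_ge0// opnorm_inj.
Qed.

Definition lincb (f : V -> W) : Prop := linear f /\ completely_bounded f.

Lemma app_scale n (F : 'M[V -> W]_n) m (x : 'M[V]_m) (c : C) :
  (forall i j, linear (F i j)) ->
  app F (map_mx ( *:%R c) x) = map_mx ( *:%R c) (app F x).
Proof.
move=> lF; apply/matrixP => p q; rewrite !mxE.
set f := F _ _; have lf : linear f by exact: lF.
have f0 : f 0 = 0.
  by have := lf (-1) 0 0; rewrite !scaler0 addr0 scaleN1r addNr.
by have := lf c (x (mxtens_unindex p).2 (mxtens_unindex q).2) 0; rewrite f0 !addr0.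
Qed.

Section Norm.
Variables (n : nat) (F : 'M[V -> W]_n).
Hypothesis Fcb : forall i j, lincb (F i j).

Let bnd : exists M, forall x : {m : nat & 'M[V]_m},
  mxnorm (app F (projT2 x)) <= M * mxnorm (projT2 x).
Proof.
have [|M MP] := @lincb_bound n F; first by move=> i j; case: (Fcb i j).
by exists M => -[].
Qed.

Lemma cbnormP m (x : 'M[V]_m) : mxnorm (app F x) <= cbnorm F * mxnorm x.
Proof.
pose N (x : {m : nat & 'M[V]_m}) : R := mxnorm (projT2 x).
pose f (x : {m : nat & 'M[V]_m}) : R := mxnorm (app F (projT2 x)).
pose s (c : R) (x : {m : nat & 'M[V]_m}) : {m : nat & 'M[V]_m} :=
  existT _ (projT1 x) (map_mx ( *:%R c%:C) (projT2 x)).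
apply: (@sup_ball_le R _ N f bnd _ s _ _ (existT _ m x)).
- by move=> ?; exact: mxnorm_ge0.
- by move=> c y c0; rewrite /N /s/= mxnormZ normcR ger0_norm.
- move=> c y c0; rewrite /f /s/= app_scale; last by move=> i j; case: (Fcb i j).
  by rewrite mxnormZ normcR ger0_norm.
Qed.

Lemma cbnorm_le M : 0 <= M ->
  (forall m (x : 'M[V]_m), mxnorm (app F x) <= M * mxnorm x) -> cbnorm F <= M.
Proof.
move=> M0 MP; pose N (x : {m : nat & 'M[V]_m}) : R := mxnorm (projT2 x).
by apply: (@sup_ball_ub R _ N) => // -[m x]; exact: MP.
Qed.

Lemma cbnorm_ge0 : 0 <= cbnorm F.
Proof.
pose N (x : {m : nat & 'M[V]_m}) : R := mxnorm (projT2 x).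
pose f (x : {m : nat & 'M[V]_m}) : R := mxnorm (app F (projT2 x)).
apply: (@sup_ball_ge0 R _ N f bnd _); first by move=> ?; exact: mxnorm_ge0.
by exists (existT (fun m => 'M[V]_m) 0%N (0 : 'M[V]_0)); rewrite /N/= ?mxnorm0// mxnorm_ge0.
Qed.

End Norm.

Lemma lincb_addZ c (f g : V -> W) : lincb f -> lincb g -> lincb (c *: f + g).
Proof.
move=> [lf [M Mf]] [lg [M' Mg]]; split=> [a x y|].
  by rewrite -![(c *: f + g) _]/(c *: f _ + g _) lf lg !scalerDr !scalerA mulrC addrACA.
exists (normc c * M + M') => n x.
have -> : map_mx (c *: f + g) x = map_mx ( *:%R c) (map_mx f x) + map_mx g x.
  by apply/matrixP => i j; rewrite !mxE.
rewrite (le_trans (ler_mxnormD _ _))// mulrDl lerD// mxnormZ -mulrA.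
by rewrite ler_wpM2l ?normc_ge0.
Qed.

Lemma lincb0 : lincb (0 : V -> W).
Proof.
split; first by move=> a x y; rewrite -![(0 : V -> W) _]/(0 : W) scaler0 addr0.
exists 0 => n x; have -> : map_mx (0 : V -> W) x = 0.
  by apply/matrixP => i j; rewrite !mxE.
by rewrite mxnorm0 mul0r.
Qed.

Lemma cbnorm_ruan : ruan_norms lincb cbnorm.
Proof.
split.
- move=> n F G hF hG.
  apply: cbnorm_le => [|m x]; first by rewrite addr_ge0 ?cbnorm_ge0.
  have -> : app (F + G) x = app F x + app G x by apply/matrixP => i j; rewrite !mxE.
  by rewrite (le_trans (ler_mxnormD _ _))// mulrDl lerD// cbnormP.
- move=> n c F hF.
  apply: cbnorm_le => [|m x]; first by rewrite mulr_ge0 ?cbnorm_ge0 ?normc_ge0.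
  have -> : app (map_mx ( *:%R c) F) x = map_mx ( *:%R c) (app F x).
    by apply/matrixP => i j; rewrite !mxE.
  by rewrite mxnormZ -mulrA ler_wpM2l ?normc_ge0// cbnormP.
- move=> n F hF F0; apply/matrixP => i j; rewrite mxE; apply/funext => v.
  have /mxnorm0_eq0/matrixP : mxnorm (app F (const_mx v : 'M[V]_1)) = 0.
    apply/eqP; rewrite eq_le mxnorm_ge0 andbT.
    by rewrite (le_trans (cbnormP hF _))// F0 mul0r.
  move=> /(_ (mxtens_index (i, 0)) (mxtens_index (j, 0))).
  by rewrite !mxE !mxtens_indexK.
- move=> n1 n2 F G hF hG; set M := Num.max _ _.
  have M0 : 0 <= M by rewrite le_max cbnorm_ge0.
  apply: cbnorm_le => // m x.
  have -> : app (block_mx F 0 0 G) x =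
      castmx (esym (mulnDl n1 n2 m), esym (mulnDl n1 n2 m))
        (block_mx (app F x) 0 0 (app G x)).
    apply/matrixP => p q; rewrite castmxE/= !esymK.
    case: (mxtens_indexP p) => i k; case: (mxtens_indexP q) => j l.
    rewrite mxE !mxtens_indexK/=.
    have idl (a : 'I_n1) (b : 'I_m) : cast_ord (mulnDl n1 n2 m)
        (mxtens_index (lshift n2 a, b)) = lshift _ (mxtens_index (a, b)).
      by apply: val_inj.
    have idr (a : 'I_n2) (b : 'I_m) : cast_ord (mulnDl n1 n2 m)
        (mxtens_index (rshift n1 a, b)) = rshift _ (mxtens_index (a, b)).
      by apply: val_inj; rewrite /= mulnDl addnA.
    case: (splitP i) => i' ii'; [have -> : i = lshift n2 i' by exact: val_inj
                                |have -> : i = rshift n1 i' by exact: val_inj];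
    (case: (splitP j) => j' jj'; [have -> : j = lshift n2 j' by exact: val_inj
                                |have -> : j = rshift n1 j' by exact: val_inj]);
    rewrite ?idl ?idr ?block_mxEul ?block_mxEur ?block_mxEdl ?block_mxEdr
      ?mxE ?mxtens_indexK//.
  rewrite mxnorm_cast mxnorm_dsum ge_max.
  rewrite !(le_trans (cbnormP _ _))// ler_wpM2r ?mxnorm_ge0// /M le_max lexx ?orbT//.
- move=> n1 n2 a F b hF.
  apply: cbnorm_le => [|m x]; first by rewrite !mulr_ge0 ?cbnorm_ge0 ?opnorm_ge0.
  have -> : app (mxact a F b) x =
      mxact (a *t (1%:M : 'M_m)) (app F x) (b *t (1%:M : 'M_m)).
    apply/matrixP => p q; case: (mxtens_indexP p) => i k; case: (mxtens_indexP q) => j l.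
    rewrite [LHS]mxE !mxtens_indexK/= !mxE fct_sumE.
    have re (g : 'I_(n1 * m) -> W) (k0 : 'I_m) : (forall i' k', k' != k0 -> g (mxtens_index (i', k')) = 0) ->
        \sum_p g p = \sum_i' g (mxtens_index (i', k0)).
      move=> g0; rewrite (reindex (@mxtens_index n1 m))/=; last first.
        by exists (@mxtens_unindex n1 m) => ? _; rewrite (mxtens_indexK, mxtens_unindexK).
      rewrite (eq_bigr (fun p => g (mxtens_index (p.1, p.2)))); last by case.
      rewrite -(pair_bigA _ (fun p q => g (mxtens_index (p, q))))/=.
      by apply: eq_bigr => i' _; rewrite (bigD1 k0)//= big1 ?addr0// => k' /g0.
    rewrite (re _ k); last first.
      move=> i' k' /negbTE kk; rewrite big1// => l' _.
      by rewrite tensmxE mxE eq_sym kk mulr0 mul0r scale0r.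
    apply: eq_bigr => i' _; rewrite fct_sumE (re _ l); last first.
      move=> j' l' /negbTE ll; rewrite tensmxE [in X in _ * X]tensmxE !mxE ll.
      by rewrite !mulr0 scale0r.
    apply: eq_bigr => j' _; rewrite !tensmxE !mxE !mxtens_indexK/= !eqxx !mulr1.
    by [].
  rewrite (le_trans (mxnorm_act _ _ _))//.
  rewrite (@le_trans _ _ (opnorm a * (cbnorm F * mxnorm x) * opnorm b))//; last first.
    by rewrite -!mulrA [opnorm b * _]mulrC.
  rewrite ler_pM ?mulr_ge0 ?opnorm_ge0 ?mxnorm_ge0 ?opnorm_tens1//.
  by rewrite ler_pM ?opnorm_ge0 ?mxnorm_ge0 ?opnorm_tens1// cbnormP.
Qed.

End CompletelyBounded.

Section BoundedFunctionals.
Variables (R : realType) (V : operatorSpaceType R).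
Notation C := R[i].

Lemma normCoE (z : C^o) : `|z| = (normc z)%:C. Proof. by []. Qed.

Lemma linear_ex (f : V -> C^o) : linear f -> exists F : {linear V -> C^o}, f = F.
Proof.
move=> lf; pose F : {linear V -> C^o} :=
  HB.pack_for {linear V -> C^o} f (GRing.isLinear.Build _ _ _ _ f lf).
by exists F.
Qed.

Lemma linear_bounded (f : V -> C^o) : linear f -> continuous f ->
  exists2 M, 0 <= M & forall v, normc (f v) <= M * vnorm v.
Proof.
move=> /linear_ex[F ->{f}] cf.
have /linear_boundedP : bounded_near F (nbhs 0).
  by apply: continuous_linear_bounded; exact: cf.
case=> M [Mr MP].
have Mn : `|M| + 1 > M.
  by rewrite (le_lt_trans (real_ler_norm Mr))// ltrDl.
exists (normc M + 1); first by rewrite addr_ge0 ?normc_ge0.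
move=> v; have := MP _ Mn v; rewrite (vnormE v) (normCoE (F v)) (normCE M).
by rewrite -(rmorph1 (real_complex R)) -rmorphD -rmorphM/= lecR.
Qed.

Lemma bounded_continuous (f : V -> C^o) (M : R) : linear f ->
  (forall v, normc (f v) <= M * vnorm v) -> continuous f.
Proof.
move=> /linear_ex[F ->{f}] fM; apply: bounded_linear_continuous.
apply/linear_boundedP; exists (M%:C); split; first by apply/Creal_ImP; rewrite -complexIm.
move=> x Mx v; rewrite normCoE.
apply: (@le_trans _ _ (M%:C * `|v|)); first by rewrite vnormE -rmorphM/= lecR.
by rewrite ler_wpM2r// ltW.
Qed.

Lemma functional_cb_bound (f : V -> C^o) M : linear f -> 0 <= M ->
  (forall v, normc (f v) <= M * vnorm v) ->
  forall n (x : 'M[V]_n), mxnorm (map_mx f x) <= M * mxnorm x.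
Proof.
move=> /linear_ex[F ->{f}] M0 fM n x.
apply: opnorm_le => [|v]; first by rewrite mulr_ge0 ?mxnorm_ge0.
set w := _ *m v.
have [->|w0] := eqVneq w 0.
  by rewrite l2norm0 !mulr_ge0 ?mxnorm_ge0 ?l2norm_ge0.
have wp : 0 < l2norm w.
  by rewrite lt_def l2norm_ge0 andbT; apply: contra_neq w0 => /l2norm_eq0.
rewrite -(ler_pM2l wp) -expr2.
pose z : 'M[V]_1 := mxact (\row_i (w i 0)^*%C) x v.
have fz : F (z 0 0) = (l2norm w ^+ 2)%:C.
  rewrite mxE linear_sum l2norm_sqr rmorph_sum/=.
  apply: eq_bigr => i _; rewrite linear_sum/=.
  have -> : (normc (w i 0) ^+ 2)%:C = (w i 0)^*%C * w i 0.
    by rewrite rmorphXn/= -normCE sqr_normc mulrC.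
  rewrite [in X in _ * X]mxE mulr_sumr; apply: eq_bigr => j _.
  by rewrite linearZ/= !mxE -[LHS]/(_ * _ * F (x i j)) -mulrA [v j 0 * _]mulrC.
have := fM (z 0 0); rewrite fz normcR ger0_norm ?sqr_ge0// => h.
rewrite (le_trans h)// -mxnormE1 (@le_trans _ _ (M * (l2norm w * mxnorm x * l2norm v)))//.
  rewrite ler_wpM2l// (le_trans (mxnorm_act _ _ _))//.
  rewrite ler_pM ?mulr_ge0 ?opnorm_ge0 ?mxnorm_ge0 ?opnorm_col//.
  by rewrite ler_wpM2r ?mxnorm_ge0// opnorm_row.
by rewrite le_eqVlt; apply/orP; left; apply/eqP; ring.
Qed.

Lemma functional_cb (f : V -> C^o) : linear f -> continuous f -> completely_bounded f.
Proof.
move=> lf cf; have [M M0 fM] := linear_bounded lf cf.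
by exists M; exact: functional_cb_bound.
Qed.

End BoundedFunctionals.

Section CBMap.
Variables (R : realType) (V W : operatorSpaceType R).

Definition cb_pred : {pred V -> W} := fun f => `[< linear f /\ completely_bounded f >].

Lemma cb_predP (f : V -> W) : reflect (lincb f) (f \in cb_pred).
Proof. exact: asboolP. Qed.

Let cb_submod : submod_closed cb_pred.
Proof.
split; first by apply/cb_predP; exact: lincb0.
by move=> c f g /cb_predP lf /cb_predP lg; apply/cb_predP; exact: lincb_addZ.
Qed.

HB.instance Definition _ :=
  GRing.isSubmodClosed.Build R[i] (V -> W) cb_pred cb_submod.

(* CB(V, W) *)
Record cbmap := CBMap { cbmap_fun :> V -> W ; _ : cbmap_fun \in cb_pred }.

HB.instance Definition _ := [isSub for cbmap_fun].
HB.instance Definition _ := [Choice of cbmap by <:].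
HB.instance Definition _ := [SubChoice_isSubLmodule of cbmap by <:].

Definition cbmap_norm n (T : 'M[cbmap]_n) : R := cbnorm (map_mx cbmap_fun T).

Let cbmap_ruan : ruan_norms (fun=> True) cbmap_norm.
Proof.
apply: (@ruan_pullback R cbmap (V -> W) val _ _ _ _ (@cbnorm_ruan R V W)).
  exact: val_inj.
by move=> f; apply/cb_predP; exact: valP.
Qed.

HB.instance Definition _ := Lmodule_isOperatorSpace.Build R cbmap cbmap_ruan.

Lemma cbmap_lin (f : cbmap) : linear f.
Proof. by have /cb_predP[] := valP f. Qed.

Lemma cbmap_cb (f : cbmap) : completely_bounded f.
Proof. by have /cb_predP[] := valP f. Qed.

End CBMap.

Section Dual.
Variables (R : realType) (V : operatorSpaceType R).

Definition dual_pred : {pred V -> R[i]^o} :=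
  fun f => `[< linear f /\ continuous f >].

Lemma dual_predP (f : V -> R[i]^o) :
  reflect (linear f /\ continuous f) (f \in dual_pred).
Proof. exact: asboolP. Qed.

Let dual_submod : submod_closed dual_pred.
Proof.
split.
  by apply/dual_predP; split; [case: (lincb0 V R[i]^o)|move=> ?; exact: cst_continuous].
move=> c f g /dual_predP[lf cf] /dual_predP[lg cg]; apply/dual_predP; split.
  have [] // := @lincb_addZ _ _ _ c f g; split=> //; exact: functional_cb.
by move=> x; apply: continuousD; [apply: continuousZr; exact: cf|exact: cg].
Qed.

HB.instance Definition _ :=
  GRing.isSubmodClosed.Build R[i] (V -> R[i]^o) dual_pred dual_submod.

Record dual := Dual { dual_fun :> V -> R[i]^o ; _ : dual_fun \in dual_pred }.

HB.instance Definition _ := [isSub for dual_fun].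
HB.instance Definition _ := [Choice of dual by <:].
HB.instance Definition _ := [SubChoice_isSubLmodule of dual by <:].

(* M_n(V') = CB(V, M_n(C)). *)
Definition dual_norm n (F : 'M[dual]_n) : R := cbnorm (map_mx dual_fun F).

Let dual_ruan : ruan_norms (fun=> True) dual_norm.
Proof.
apply: (@ruan_pullback R dual (V -> R[i]^o) val _ _ _ _ (@cbnorm_ruan R V R[i]^o)).
  exact: val_inj.
move=> f; have /dual_predP[lf cf] := valP f.
by split=> //; exact: functional_cb.
Qed.

HB.instance Definition _ := Lmodule_isOperatorSpace.Build R dual dual_ruan.

Lemma dual_lin (f : dual) : linear f.
Proof. by have /dual_predP[] := valP f. Qed.

Lemma dual_continuous (f : dual) : continuous f.
Proof. by have /dual_predP[] := valP f. Qed.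

Lemma dual_normP (f : dual) v : normc (f v) <= vnorm f * vnorm v.
Proof.
have hF i j : lincb ((map_mx dual_fun (const_mx f : 'M_1)) i j).
  rewrite !mxE; split; first exact: dual_lin.
  by apply: functional_cb; [exact: dual_lin|exact: dual_continuous].
have := cbnormP hF (const_mx v : 'M[V]_1).
rewrite (@mxnormE1 _ R[i]^o) !mxE => h; rewrite (le_trans _ h)//.
by rewrite -lecR -normCE -(vnormE (f v : R[i]^o)).
Qed.

Lemma dual_norm_le (f : dual) M : 0 <= M ->
  (forall v, normc (f v) <= M * vnorm v) -> vnorm f <= M.
Proof.
move=> M0 fM; apply: cbnorm_le => // m x.
set y := mxkron _ _ _.
have -> : y = castmx (esym (mul1n m), esym (mul1n m)) (map_mx f x).
  apply/matrixP => p q; rewrite castmxE/= !mxE !esymK.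
  by congr (f (x _ _)); apply: val_inj; rewrite /= modn_small// -[leqRHS]mul1n.
rewrite mxnorm_cast; apply: functional_cb_bound => //; exact: dual_lin.
Qed.

Lemma bounded_dual (f : V -> R[i]^o) M : linear f ->
  (forall v, normc (f v) <= M * vnorm v) -> f \in dual_pred.
Proof.
by move=> lf fM; apply/dual_predP; split=> //; exact: bounded_continuous fM.
Qed.

End Dual.

(* No unit is assumed, so the ring structures do not apply. *)
Record cc_banach_algebra (R : realType) (A : operatorSpaceType R)
    (mul : A -> A -> A) : Prop := CCBanachAlgebraAxioms {
  ccba_complete : forall F : set_system A, ProperFilter F -> cauchy F -> cvg F ;
  ccba_mulA : associative mul ;
  ccba_mull : forall b, linear (fun a => mul a b) ;
  ccba_mulr : forall a, linear (mul a) ;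
  ccba_jcc : forall r s (a : 'M[A]_r) (b : 'M[A]_s),
    mxnorm (mxkron mul a b) <= mxnorm a * mxnorm b }.

HB.mixin Record OperatorSpace_isCCBanachAlgebra (R : realType) A
    & OperatorSpace R A := {
  amul : A -> A -> A ;
  amulP : cc_banach_algebra amul }.

#[short(type="ccBanachAlgType")]
HB.structure Definition CCBanachAlgebra (R : realType) :=
  {A of OperatorSpace R A & OperatorSpace_isCCBanachAlgebra R A}.

Definition directed_rel (I : Type) (le : I -> I -> Prop) : Prop :=
  [/\ inhabited I, (forall i, le i i),
      (forall i j k, le i j -> le j k -> le i k) &
      forall i j, exists2 k, le i k & le j k].

Definition tail_filter (I : Type) (le : I -> I -> Prop) : set_system I :=
  [set P | exists i0, forall i, le i0 i -> P i].

Definition has_contractive_right_approx_id (R : realType) (A : ccBanachAlgType R) : Prop :=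
  exists (I : Type) (le : I -> I -> Prop) (e : I -> A),
    [/\ directed_rel le, (forall i, `|e i| <= 1) &
        forall a, amul a (e i) @[i --> tail_filter le] --> a].

Definition linear_span (K : nzRingType) (V : lmodType K) (S : set V) : set V :=
  [set v | exists n (c : 'I_n -> K) (s : 'I_n -> V),
     (forall i, S (s i)) /\ v = \sum_i c i *: s i].

Section Algebra.
Variables (R : realType) (A : ccBanachAlgType R).
Notation C := R[i].

Lemma vnorm_amul (a b : A) : vnorm (amul a b) <= vnorm a * vnorm b.
Proof.
have := ccba_jcc amulP (const_mx a : 'M[A]_1) (const_mx b : 'M[A]_1).
suff -> : mxkron amul (const_mx a : 'M[A]_1) (const_mx b : 'M[A]_1) =
  const_mx (amul a b) by [].
by apply/matrixP => i j; rewrite !mxE.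
Qed.

Fact dual_act_subproof (f : dual A) (a : A) :
  (fun b => f (amul a b)) \in @dual_pred R A.
Proof.
apply: (@bounded_dual _ _ _ (vnorm f * vnorm a)) => [c x y|v].
  by rewrite (ccba_mulr amulP) dual_lin.
by rewrite (le_trans (dual_normP _ _))// -mulrA ler_wpM2l ?mxnorm_ge0// vnorm_amul.
Qed.

(* <f . a, b> = <f, a b> *)
Definition dual_act (f : dual A) (a : A) : dual A := Dual (dual_act_subproof f a).

Lemma dual_actA f a b : dual_act (dual_act f a) b = dual_act f (amul a b).
Proof. by apply/val_inj/funext => c /=; rewrite (ccba_mulA amulP). Qed.

Lemma vnorm_dual_act f a : vnorm (dual_act f a) <= vnorm f * vnorm a.
Proof.
apply: dual_norm_le => [|v]; first by rewrite mulr_ge0 ?mxnorm_ge0.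
by rewrite /= (le_trans (dual_normP _ _))// -mulrA ler_wpM2l ?mxnorm_ge0// vnorm_amul.
Qed.

Lemma dual_act_linl a : linear (dual_act^~ a).
Proof. by move=> c f g; apply/val_inj/funext. Qed.

Lemma dual_act_linr f : linear (dual_act f).
Proof.
move=> c a b; apply/val_inj/funext => v /=.
by rewrite (ccba_mull amulP) dual_lin.
Qed.

Definition luc_pred : {pred dual A} := fun f =>
  `[< closure (linear_span [set dual_act g a | g in setT & a in setT]) f >].

Lemma span_subspace (K : nzRingType) (V : lmodType K) (S : set V) c u v :
  linear_span S u -> linear_span S v -> linear_span S (c *: u + v).
Proof.
move=> [n [d [s [sS ->]]]] [m [d' [s' [s'S ->]]]].
exists (n + m)%N, (fun i : 'I_(n + m) => match fintype.split i with inl j => c * d j | inr j => d' j end),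
  (fun i : 'I_(n + m) => match fintype.split i with inl j => s j | inr j => s' j end).
split; first by move=> i; case: fintype.split.
rewrite big_split_ord/= scaler_sumr; congr (_ + _); apply: eq_bigr => i _.
  by rewrite (unsplitK (inl i)) scalerA.
by rewrite (unsplitK (inr i)).
Qed.

Lemma span_sub (K : nzRingType) (V : lmodType K) (S : set V) u :
  S u -> linear_span S u.
Proof.
move=> Su; exists 1%N, (fun=> 1), (fun=> u); split=> //.
by rewrite big_ord1 scale1r.
Qed.

Let luc_submod : submod_closed luc_pred.
Proof.
have S0 : linear_span [set dual_act g a | g in setT & a in setT] (0 : dual A).
  by exists 0%N, (fun=> 0), (fun=> 0); split; [case|rewrite big_ord0].
split; first by apply/asboolP; exact: subset_closure.
move=> c f g /asboolP cf /asboolP cg; apply/asboolP => B.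
have : (fun z : dual A * dual A => c *: z.1 + z.2) @ (f, g) --> c *: f + g.
  by apply: cvgD; [apply: cvgZr; exact: cvg_fst|exact: cvg_snd].
move=> h /h [[B1 B2]/= [B1f B2g] sB].
have [u [Su B1u]] := cf _ B1f; have [v [Sv B2v]] := cg _ B2g.
exists (c *: u + v); split; first exact: span_subspace.
exact: (sB (u, v)).
Qed.

HB.instance Definition _ :=
  GRing.isSubmodClosed.Build R[i] (dual A) luc_pred luc_submod.

(* LUC(A'), the norm-closed linear span of A' . A. *)
Record luc := LUC { luc_val :> dual A ; _ : luc_val \in luc_pred }.

HB.instance Definition _ := [isSub for luc_val].
HB.instance Definition _ := [Choice of luc by <:].
HB.instance Definition _ := [SubChoice_isSubLmodule of luc by <:].

Definition luc_norm n (F : 'M[luc]_n) : R := mxnorm (map_mx luc_val F).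

Lemma mxnorm_ruan (V : operatorSpaceType R) :
  ruan_norms (fun=> True) (fun n (x : 'M[V]_n) => mxnorm x).
Proof.
split=> *; [exact: ler_mxnormD|by rewrite mxnormZ|exact: mxnorm0_eq0
  |by rewrite mxnorm_dsum|exact: mxnorm_act].
Qed.

Let luc_ruan : ruan_norms (fun=> True) luc_norm.
Proof.
by apply: (@ruan_pullback R luc (dual A) val _ _ _ _ (mxnorm_ruan _)) => //;
  exact: val_inj.
Qed.

HB.instance Definition _ := Lmodule_isOperatorSpace.Build R luc luc_ruan.

Fact luc_act_subproof (f : dual A) a : dual_act f a \in luc_pred.
Proof.
by apply/asboolP/subset_closure/span_sub; exists f => //; exists a.
Qed.

(* f . a as an element of LUC(A'). *)
Definition luc_act (f : dual A) (a : A) : luc := LUC (luc_act_subproof f a).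

Lemma vnorm_luc (f : luc) : vnorm f = vnorm (f : dual A).
Proof.
by rewrite /vnorm -[LHS]/(luc_norm _); congr mxnorm; apply/matrixP => i j; rewrite !mxE.
Qed.

Lemma luc_act_linr f : linear (luc_act f).
Proof. by move=> c a b; apply: val_inj; exact: dual_act_linr. Qed.

Lemma luc_act_linl a : linear (luc_act^~ a).
Proof. by move=> c f g; apply: val_inj; exact: dual_act_linl. Qed.

Lemma luc_act_bound (mu : dual luc) (f : dual A) a :
  normc (mu (luc_act f a)) <= vnorm mu * vnorm f * vnorm a.
Proof.
rewrite (le_trans (dual_normP _ _))// -mulrA ler_wpM2l ?mxnorm_ge0//.
by rewrite vnorm_luc vnorm_dual_act.
Qed.

Fact lmul_dual_subproof (mu : dual luc) (f : dual A) :
  (fun a => mu (luc_act f a)) \in @dual_pred R A.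
Proof.
apply: (@bounded_dual _ _ _ (vnorm mu * vnorm f)) => [c x y|v].
  by rewrite luc_act_linr dual_lin.
exact: luc_act_bound.
Qed.

(* <mu [] f, a> = <mu, f . a>, for any f in A'. *)
Definition lmul_dual (mu : dual luc) (f : dual A) : dual A :=
  Dual (lmul_dual_subproof mu f).

Lemma lmul_dual_lin mu : linear (lmul_dual mu).
Proof.
by move=> c f g; apply/val_inj/funext => a /=; rewrite luc_act_linl dual_lin.
Qed.

Lemma lmul_dual_linear mu : exists F : {linear dual A -> dual A}, lmul_dual mu = F.
Proof.
pose F : {linear dual A -> dual A} :=
  HB.pack_for {linear dual A -> dual A} (lmul_dual mu)
    (GRing.isLinear.Build _ _ _ _ (lmul_dual mu) (lmul_dual_lin mu)).
by exists F.
Qed.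

Lemma vnorm_lmul_dual mu f : vnorm (lmul_dual mu f) <= vnorm mu * vnorm f.
Proof.
apply: dual_norm_le => [|v]; first by rewrite mulr_ge0 ?mxnorm_ge0.
exact: luc_act_bound.
Qed.

Lemma lmul_dual_act mu f a : lmul_dual mu (dual_act f a) = dual_act (lmul_dual mu f) a.
Proof.
apply/val_inj/funext => b /=; congr (mu _); apply: val_inj; exact: dual_actA.
Qed.

Lemma lmul_dual_span mu (f : dual A) :
  linear_span [set dual_act g a | g in setT & a in setT] f ->
  linear_span [set dual_act g a | g in setT & a in setT] (lmul_dual mu f).
Proof.
move=> [n [c [s [sS ->]]]]; exists n, c, (fun i => lmul_dual mu (s i)); split.
  move=> i; have [g _ [a _ <-]] := sS i.
  by exists (lmul_dual mu g) => //; exists a => //; rewrite lmul_dual_act.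
have [F FE] := lmul_dual_linear mu.
by rewrite FE linear_sum; apply: eq_bigr => i _; rewrite linearZ.
Qed.

Fact luc_lmul_subproof (mu : dual luc) (f : luc) : lmul_dual mu f \in luc_pred.
Proof.
have /asboolP cf := valP f; apply/asboolP.
have cont : continuous (lmul_dual mu).
  have [F FE] := lmul_dual_linear mu.
  rewrite FE; apply: bounded_linear_continuous; apply/linear_boundedP.
  exists ((vnorm mu)%:C); split; first by apply/Creal_ImP; rewrite -complexIm.
  move=> x Mx v; rewrite -FE.
  apply: (@le_trans _ _ ((vnorm mu)%:C * `|v|)).
    by rewrite !vnormE -rmorphM/= lecR vnorm_lmul_dual.
  by rewrite ler_wpM2r// ltW.
move=> B /cont /cf [u [Su Bu]]; exists (lmul_dual mu u); split => //.
exact: lmul_dual_span.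
Qed.

(* The product mu [] f restricted to LUC(A'), which it preserves. *)
Definition luc_lmul (mu : dual luc) (f : luc) : luc := LUC (luc_lmul_subproof mu f).

Lemma luc_lmul_lin mu : linear (luc_lmul mu).
Proof.
move=> c f g; apply: val_inj.
exact: (lmul_dual_lin mu c (luc_val f) (luc_val g)).
Qed.

Fact luc_dual_mul_subproof (mu nu : dual luc) :
  (fun f => mu (luc_lmul nu f)) \in @dual_pred R luc.
Proof.
apply: (@bounded_dual _ _ _ (vnorm mu * vnorm nu)) => [c x y|v].
  by rewrite luc_lmul_lin dual_lin.
apply: (le_trans (dual_normP mu (luc_lmul nu v))).
rewrite -mulrA; apply: ler_wpM2l; first exact: mxnorm_ge0.
rewrite (vnorm_luc (luc_lmul nu v)) (vnorm_luc v).
exact: vnorm_lmul_dual.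
Qed.

(* <mu [] nu, f> = <mu, nu [] f> *)
Definition luc_dual_mul (mu nu : dual luc) : dual luc := Dual (luc_dual_mul_subproof mu nu).

End Algebra.

Section Composition.
Variables (R : realType) (U V W : operatorSpaceType R).

Fact cb_comp_subproof (S : cbmap V W) (T : cbmap U V) :
  S \o T \in @cb_pred R U W.
Proof.
apply/cb_predP; split=> [c x y|]; first by rewrite /= !cbmap_lin.
have [M MS] := cbmap_cb S; have [N NT] := cbmap_cb T.
exists (`|M| * N) => n x; rewrite map_mx_comp.
apply: (le_trans (MS _ _)); apply: (@le_trans _ _ (`|M| * mxnorm (map_mx T x))).
  by rewrite ler_wpM2r ?mxnorm_ge0// ler_norm.
by rewrite -mulrA ler_wpM2l.
Qed.

Definition cb_comp (S : cbmap V W) (T : cbmap U V) : cbmap U W :=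
  CBMap (cb_comp_subproof S T).

End Composition.

Definition complete_isometry (R : realType) (V W : operatorSpaceType R)
    (f : V -> W) : Prop :=
  forall n (x : 'M[V]_n), mxnorm (map_mx f x) = mxnorm x.

Section ModuleMaps.
Variables (R : realType) (A : ccBanachAlgType R).

Definition cbmod_pred : {pred cbmap (dual A) (dual A)} := fun T =>
  `[< forall f a, T (dual_act f a) = dual_act (T f) a >].

Let cbmod_submod : submod_closed cbmod_pred.
Proof.
split; first by apply/asboolP => f a; apply/val_inj/funext.
move=> c S T /asboolP hS /asboolP hT; apply/asboolP => f a.
rewrite -[LHS]/(c *: S (dual_act f a) + T (dual_act f a)) hS hT.
by rewrite -[RHS]/(dual_act (c *: S f + T f) a) dual_act_linl.
Qed.

HB.instance Definition _ := GRing.isSubmodClosed.Build R[i]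
  (cbmap (dual A) (dual A)) cbmod_pred cbmod_submod.

(* CB_A(A'), with A' the dual of A *)
Record cbmod := CBMod {
  cbmod_val :> cbmap (dual A) (dual A) ; _ : cbmod_val \in cbmod_pred }.

HB.instance Definition _ := [isSub for cbmod_val].
HB.instance Definition _ := [Choice of cbmod by <:].
HB.instance Definition _ := [SubChoice_isSubLmodule of cbmod by <:].

Definition cbmod_norm n (T : 'M[cbmod]_n) : R := mxnorm (map_mx cbmod_val T).

Let cbmod_ruan : ruan_norms (fun=> True) cbmod_norm.
Proof.
apply: (@ruan_pullback R cbmod (cbmap (dual A) (dual A)) val _ _ _ _
  (mxnorm_ruan _)) => //; exact: val_inj.
Qed.

HB.instance Definition _ := Lmodule_isOperatorSpace.Build R cbmod cbmod_ruan.

Fact cbmod_comp_subproof (S T : cbmod) : cb_comp S T \in cbmod_pred.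
Proof.
have /asboolP hS := valP S; have /asboolP hT := valP T.
by apply/asboolP => f a /=; rewrite hT hS.
Qed.

Definition cbmod_comp (S T : cbmod) : cbmod := CBMod (cbmod_comp_subproof S T).

End ModuleMaps.

Section ProjectiveTensor.
Variables (R : realType) (V W : operatorSpaceType R).
Notation C := R[i].

Record bilin := Bilin {
  bilin_fun :> V -> W -> C^o ;
  bilin_linl : forall w, linear (bilin_fun^~ w) ;
  bilin_linr : forall v, linear (bilin_fun v) }.

(* The algebraic tensor product is realized in the dual of the space of all
   bilinear forms, v (x) w being evaluation at (v, w). *)
Definition elem_tensor (v : V) (w : W) : bilin -> C^o := fun B => B v w.

Definition alg_tensor : set (bilin -> C^o) :=
  linear_span [set elem_tensor v w | v in setT & w in setT].

(* The operator space projective norm on M_n(V (x) W): the infimum of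
   |a| |v| |w| |b| over the factorizations u = a (v (x) w) b. *)
Definition proj_norm n (u : 'M[bilin -> C^o]_n) : R :=
  inf [set r | exists p q (a : 'M[C]_(n, p * q)) (v : 'M[V]_p) (w : 'M[W]_q)
                 (b : 'M[C]_(p * q, n)),
         u = mxact a (mxkron elem_tensor v w) b /\
         r = opnorm a * mxnorm v * mxnorm w * opnorm b].

(* Points of the completed projective tensor product, given by Cauchy sequences
   of algebraic tensors. Equivalent sequences are not identified: they define the
   same functionals on CB(V, W'), hence the same weak* topology. *)
Record ptensor := PTensor {
  ptensor_seq :> nat -> bilin -> C^o ;
  ptensor_tensor : forall n, alg_tensor (ptensor_seq n) ;
  ptensor_cauchy : forall e : R, 0 < e -> exists N, forall m n,
    (N <= m)%N -> (N <= n)%N ->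
    proj_norm (const_mx (ptensor_seq m - ptensor_seq n) : 'M_1) < e }.

Definition cb_bilin (T : cbmap V (dual W)) : bilin.
Proof.
exists (fun v w => T v w) => [w|v]; last exact: dual_lin.
by move=> c x y; rewrite cbmap_lin.
Defined.

(* The pairing CB(V, W') = the dual of V (x)^ W, with <T, v (x) w> = <T v, w>. *)
Definition cb_pairing (T : cbmap V (dual W)) : {ptws ptensor -> C^o} :=
  fun u => lim (u n (cb_bilin T) @[n --> \oo]).

Definition wstar_cb : Type := initial_topology cb_pairing.
HB.instance Definition _ := Topological.on wstar_cb.

End ProjectiveTensor.

Section WeakStar.
Variable R : realType.

Definition dual_pairing (V : operatorSpaceType R) (f : dual V) : {ptws V -> R[i]^o} := f.

Definition wstar_dual (V : operatorSpaceType R) : Type := initial_topology (@dual_pairing V).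
HB.instance Definition _ (V : operatorSpaceType R) := Topological.on (wstar_dual V).

(* The relative weak* topology of CB_A(A') in CB(A'). *)
Definition wstar_cbmod (A : ccBanachAlgType R) : Type :=
  initial_topology (fun T : cbmod A => cbmod_val T : wstar_cb (dual A) A).
HB.instance Definition _ (A : ccBanachAlgType R) := Topological.on (wstar_cbmod A).

End WeakStar.

(* Main.v *)
(** An element of LUC(A') is an absolutely convergent series of elements f . a:
    put f_0 = f and f_{n+1} = f_n - f_n . e_n, with e_n taken in the approximate
    identity so far out that |f_{n+1}| <= 2^-(n+1); then f = sum_n f_n . e_n.
    Hence the action maps the completed projective tensor product of A' and A
    onto LUC(A'), and the weak* topologies of CB_A(A') and LUC(A')' are pointwise
    convergence on the same vectors. The functional attached to T is
    f |-> lim_i <T f, e_i>, and the inverse sends mu to f |-> mu [] f; both are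
    completely contractive, the first because each |e_i| <= 1. *)

Require Import Defs.
From HB Require Import structures.
From mathcomp Require Import all_boot all_order all_algebra.
From mathcomp Require Import complex mxtens.
From mathcomp Require Import all_classical all_reals.
From mathcomp Require Import topology normedtype.
From mathcomp Require Import ring.

Set Implicit Arguments.
Unset Strict Implicit.
Unset Printing Implicit Defensive.
Import Order.TTheory GRing.Theory Num.Theory.
Import numFieldNormedType.Exports.
Import ComplexField.Normc.
Local Open Scope classical_set_scope.
Local Open Scope ring_scope.
Local Open Scope complex_scope.

(** * Kronecker products of matrices *)

(** Lifts a scalar identity such as <f . a, b> = <f, ab> to matrices. The index sets (m * n) * p and
    m * (n * p) enumerate triples in the same order, so only a cast is left, and matrix norms ignore
    casts. *)
Lemma mxkron_assoc (U V W X Y Z : Type) (f : X -> W -> Z) (g : U -> V -> X)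
    (h : U -> Y -> Z) (k : V -> W -> Y) m n p
    (x : 'M[U]_m) (y : 'M[V]_n) (z : 'M[W]_p) :
  (forall u v w, f (g u v) w = h u (k v w)) ->
  mxkron f (mxkron g x y) z =
  castmx (mulnA m n p, mulnA m n p) (mxkron h x (mxkron k y z)).
Proof.
move=> fg; apply/matrixP => i j.
case: (mxtens_indexP i) => ab c; case: (mxtens_indexP ab) => a b.
case: (mxtens_indexP j) => ab' c'; case: (mxtens_indexP ab') => a' b'.
have castE (a0 : 'I_m) (b0 : 'I_n) (c0 : 'I_p) :
    cast_ord (esym (mulnA m n p)) (mxtens_index (mxtens_index (a0, b0), c0)) =
    mxtens_index (a0, mxtens_index (b0, c0)).
  by apply: val_inj; rewrite /= mulnDl mulnA addnA.
by rewrite castmxE/= !castE !mxE !mxtens_indexK/= fg.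
Qed.

(** Turns a bound on Kronecker products into one on the amplifications of a single map, by taking a
    first factor of size 1. *)
Lemma mxkron_const1 (U V W : Type) (f : U -> V -> W) n (u : U) (x : 'M[V]_n) :
  mxkron f (const_mx u : 'M_1) x =
  castmx (esym (mul1n n), esym (mul1n n)) (map_mx (f u) x).
Proof.
apply/matrixP => p q; rewrite castmxE/= !mxE !esymK.
by congr (f _ (x _ _)); apply: val_inj; rewrite /= modn_small// -[leqRHS]mul1n.
Qed.

(** * Matrix norms on CB(V, W) and on dual spaces *)

Section MatrixNorms.
Variables (R : realType) (V W : operatorSpaceType R).

Lemma mxnorm_app_cbmap n m (T : 'M[cbmap V W]_n) (x : 'M[V]_m) :
  mxnorm (mxkron (fun (f : cbmap V W) v => f v) T x) <= mxnorm T * mxnorm x.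
Proof.
have -> : mxkron (fun (f : cbmap V W) v => f v) T x =
    mxkron (fun f v => f v) (map_mx (@cbmap_fun _ _ _) T) x.
  by apply/matrixP => p q; rewrite !mxE.
by apply: cbnormP => i j; rewrite mxE; split; [exact: cbmap_lin|exact: cbmap_cb].
Qed.

Lemma mxnorm_app_dual n m (F : 'M[dual V]_n) (x : 'M[V]_m) :
  mxnorm (mxkron (fun (f : dual V) v => f v) F x : 'M[R[i]^o]_(n * m)) <=
  mxnorm F * mxnorm x.
Proof.
have -> : mxkron (fun (f : dual V) v => f v) F x =
    mxkron (fun f v => f v) (map_mx (@dual_fun _ _) F) x.
  by apply/matrixP => p q; rewrite !mxE.
apply: cbnormP => i j; rewrite mxE; split; first exact: dual_lin.
by apply: functional_cb; [exact: dual_lin|exact: dual_continuous].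
Qed.

Lemma mxnorm_cbmap_le n (T : 'M[cbmap V W]_n) (M : R) : 0 <= M ->
  (forall m (x : 'M[V]_m),
    mxnorm (mxkron (fun (f : cbmap V W) v => f v) T x) <= M * mxnorm x) ->
  mxnorm T <= M.
Proof.
move=> M0 TM; apply: cbnorm_le => // m x.
have -> : mxkron (fun f v => f v) (map_mx (@cbmap_fun R V W) T) x =
    mxkron (fun (f : cbmap V W) v => f v) T x.
  by apply/matrixP => p q; rewrite !mxE.
exact: TM.
Qed.

Lemma mxnorm_dual_le n (F : 'M[dual V]_n) (M : R) : 0 <= M ->
  (forall m (x : 'M[V]_m),
    mxnorm (mxkron (fun (f : dual V) v => f v) F x : 'M[R[i]^o]_(n * m)) <=
    M * mxnorm x) ->
  mxnorm F <= M.
Proof.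
move=> M0 FM; apply: (@cbnorm_le R V R[i]^o n (map_mx (@dual_fun R V) F) M M0) => m x.
have -> : mxkron (fun f v => f v) (map_mx (@dual_fun R V) F) x =
    mxkron (fun (f : dual V) v => f v) F x :> 'M[R[i]^o]_(n * m).
  by apply/matrixP => p q; rewrite !mxE.
exact: FM.
Qed.

(** Write x as the sum of its entries placed between a unit column and a unit row, both of operator
    norm at most 1. This crude bound lets entrywise limits control matrix norms. *)
Lemma mxnorm_entry_le n (x : 'M[V]_n) :
  mxnorm x <= \sum_i \sum_j vnorm (x i j).
Proof.
have {1}-> : x = \sum_i \sum_j
    mxact (delta_mx i 0) (const_mx (x i j) : 'M_1) (delta_mx 0 j).
  apply/matrixP => p q; rewrite summxE (bigD1 p)//= summxE (bigD1 q)//=.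
  rewrite [X in _ + X + _]big1 ?addr0 => [|j jq]; last first.
    by rewrite mxE !big_ord1 !mxE !eqxx/= [q == j]eq_sym (negbTE jq) mulr0 scale0r.
  rewrite [X in _ + X]big1 ?addr0 => [|i ip]; last first.
    rewrite summxE big1// => j _.
    by rewrite mxE !big_ord1 !mxE [p == i]eq_sym (negbTE ip) mul0r scale0r.
  by rewrite mxE !big_ord1 !mxE !eqxx mulr1 scale1r.
have delta1 m k (i : 'I_m) (j : 'I_k) : opnorm (delta_mx i j : 'M[R[i]]_(m, k)) <= 1.
  apply: opnorm_le => // v; rewrite mul1r.
  have -> : (delta_mx i j : 'M[R[i]]_(m, k)) *m v = v j 0 *: delta_mx i 0.
    apply/matrixP => p q; rewrite ord1 !mxE (bigD1 j)//= big1 ?addr0.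
      by rewrite mxE eqxx !andbT mulrC.
    by move=> l lj; rewrite mxE (negbTE lj) andbF mul0r.
  rewrite l2normZ (_ : l2norm (delta_mx i 0) = 1) ?mulr1 ?l2norm_entry//.
  rewrite /l2norm (bigD1 i)//= mxE !eqxx big1 ?addr0 => [|l li].
    by rewrite normc1 expr1n sqrtr1.
  by rewrite mxE (negbTE li) normc0 expr0n.
rewrite (le_trans (mxnorm_sum _))// ler_sum// => i _.
rewrite (le_trans (mxnorm_sum _))// ler_sum// => j _.
rewrite (le_trans (mxnorm_act _ _ _))// -/(vnorm _).
rewrite -[leRHS]mulr1 ler_pM ?mulr_ge0 ?opnorm_ge0 ?mxnorm_ge0 ?delta1//.
by rewrite -[leRHS]mul1r ler_wpM2r ?mxnorm_ge0 ?delta1.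
Qed.

End MatrixNorms.

(** * Amplified module actions and the product on LUC(A')' *)

Section ModuleActions.
Variables (R : realType) (A : ccBanachAlgType R).

(** Tested on a matrix x over A, the action becomes f applied to the product of a and x, and the
    multiplication of A is jointly completely contractive. The next estimates follow the same
    pattern, each using the previous one. *)
Lemma mxnorm_dual_act m n (f : 'M[dual A]_m) (a : 'M[A]_n) :
  mxnorm (mxkron (@dual_act R A) f a) <= mxnorm f * mxnorm a.
Proof.
apply: mxnorm_dual_le => [|p x]; first by rewrite mulr_ge0 ?mxnorm_ge0.
rewrite (mxkron_assoc (h := fun (f : dual A) v => f v) (k := amul))// mxnorm_cast.
rewrite (le_trans (mxnorm_app_dual _ _))// -mulrA ler_wpM2l ?mxnorm_ge0//.
exact: (ccba_jcc amulP).
Qed.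

Lemma mxnorm_luc n (f : 'M[luc A]_n) : mxnorm f = mxnorm (map_mx (@luc_val R A) f).
Proof. by []. Qed.

Lemma mxnorm_luc_act m n (f : 'M[dual A]_m) (a : 'M[A]_n) :
  mxnorm (mxkron (@luc_act R A) f a) <= mxnorm f * mxnorm a.
Proof.
rewrite mxnorm_luc (_ : map_mx _ _ = mxkron (@dual_act R A) f a).
  exact: mxnorm_dual_act.
by apply/matrixP => i j; rewrite !mxE.
Qed.

Lemma mxnorm_lmul_dual m n (mu : 'M[dual (luc A)]_m) (f : 'M[dual A]_n) :
  mxnorm (mxkron (@lmul_dual R A) mu f) <= mxnorm mu * mxnorm f.
Proof.
apply: mxnorm_dual_le => [|p x]; first by rewrite mulr_ge0 ?mxnorm_ge0.
rewrite (mxkron_assoc (h := fun (f : dual (luc A)) v => f v) (k := @luc_act R A))//.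
rewrite mxnorm_cast (le_trans (mxnorm_app_dual _ _))// -mulrA.
by rewrite ler_wpM2l ?mxnorm_ge0// mxnorm_luc_act.
Qed.

Lemma mxnorm_luc_dual_mul m n (mu : 'M[dual (luc A)]_m) (nu : 'M[dual (luc A)]_n) :
  mxnorm (mxkron (@luc_dual_mul R A) mu nu) <= mxnorm mu * mxnorm nu.
Proof.
apply: mxnorm_dual_le => [|p x]; first by rewrite mulr_ge0 ?mxnorm_ge0.
rewrite (mxkron_assoc (h := fun (f : dual (luc A)) v => f v) (k := @luc_lmul R A))//.
rewrite mxnorm_cast (le_trans (mxnorm_app_dual _ _))// -mulrA.
rewrite ler_wpM2l ?mxnorm_ge0// mxnorm_luc.
rewrite (_ : map_mx _ _ = mxkron (@lmul_dual R A) nu (map_mx (@luc_val R A) x)).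
  exact: mxnorm_lmul_dual.
by apply/matrixP => i j; rewrite !mxE.
Qed.

Fact luc_dual_cbmap_subproof (mu : dual (luc A)) :
  lmul_dual mu \in @cb_pred R (dual A) (dual A).
Proof.
apply/cb_predP; split; first exact: lmul_dual_lin.
exists (vnorm mu) => n x.
have := mxnorm_lmul_dual (const_mx mu : 'M_1) x.
by rewrite mxkron_const1 mxnorm_cast.
Qed.

Fact luc_dual_cbmod_subproof (mu : dual (luc A)) :
  CBMap (luc_dual_cbmap_subproof mu) \in @cbmod_pred R A.
Proof. by apply/asboolP => f a; exact: lmul_dual_act. Qed.

(** The inverse of the isomorphism, mu being sent to f |-> mu [] f on all of A'. *)
Definition luc_dual_cbmod (mu : dual (luc A)) : cbmod A :=
  CBMod (luc_dual_cbmod_subproof mu).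

Lemma cbmod_comp_pred (S T : cbmap (dual A) (dual A)) :
  S \in @cbmod_pred R A -> T \in @cbmod_pred R A -> cb_comp S T \in @cbmod_pred R A.
Proof.
by move=> /asboolP hS /asboolP hT; apply/asboolP => f a /=; rewrite hT hS.
Qed.

(** Evaluated at f and then at a, both sides reduce to nu at one vector, because xi [] (f . a) = (xi
    [] f) . a. *)
Lemma luc_dual_mulA : associative (@luc_dual_mul R A).
Proof.
move=> mu nu xi; apply/val_inj/funext => f /=; congr (mu _).
apply/val_inj/val_inj/funext => a /=; congr (nu _).
by apply/val_inj => /=; rewrite lmul_dual_act.
Qed.

Lemma luc_dual_mul_linl nu : linear (fun mu => @luc_dual_mul R A mu nu).
Proof. by move=> c mu mu'; apply/val_inj/funext. Qed.

Lemma luc_dual_mul_linr mu : linear (@luc_dual_mul R A mu).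
Proof.
move=> c nu nu'; apply/val_inj/funext => f /=.
by rewrite -[RHS]/(c *: mu (luc_lmul nu f) + mu (luc_lmul nu' f)) -dual_lin;
   congr (mu _); apply/val_inj/val_inj/funext.
Qed.

End ModuleActions.

(** * Linear maps and convergence in the real-valued norm *)

Lemma linear_subr (K : pzRingType) (U V : lmodType K) (f : U -> V) :
  linear f -> {morph f : x y / x - y}.
Proof.
by move=> lf x y; rewrite addrC -scaleN1r lf scaleN1r addrC.
Qed.

Lemma linear_scaler (K : pzRingType) (U V : lmodType K) (f : U -> V) :
  linear f -> forall c x, f (c *: x) = c *: f x.
Proof.
move=> lf c x; have f0 : f 0 = 0 by have := linear_subr lf 0 0; rewrite !subrr.
by rewrite -[c *: x]addr0 lf f0 addr0.
Qed.

Section Convergence.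
Variables (R : realType) (V : operatorSpaceType R).

Lemma normC_gt0P (e : R[i]) : 0 < e -> exists2 r : R, 0 < r & e = r%:C.
Proof.
move=> e0; exists (complex.Re e); first by rewrite -ltcR RRe_real// gtr0_real.
by rewrite RRe_real// gtr0_real.
Qed.

Lemma vnormD (x y : V) : vnorm (x + y) <= vnorm x + vnorm y.
Proof. by rewrite -lecR rmorphD/= -!vnormE ler_normD. Qed.

Lemma vnormZ c (x : V) : vnorm (c *: x) = normc c * vnorm x.
Proof. by apply/complexI; rewrite rmorphM/= -!vnormE normrZ. Qed.

Lemma vnormN (x : V) : vnorm (- x) = vnorm x.
Proof. by apply/complexI; rewrite -!vnormE normrN. Qed.

Lemma vnorm_distC (x y : V) : vnorm (x - y) = vnorm (y - x).
Proof. by rewrite -vnormN opprB. Qed.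

Lemma vnorm_ge0 (x : V) : 0 <= vnorm x.
Proof. exact: mxnorm_ge0. Qed.

Lemma vnorm_eq0 (x : V) : vnorm x = 0 -> x = 0.
Proof. by move=> x0; apply/normr0_eq0; rewrite vnormE x0. Qed.

Lemma vnorm_cvgP (I : Type) (F : set_system I) {FF : Filter F} (x : I -> V) (l : V) :
  x i @[i --> F] --> l <->
  forall e : R, 0 < e -> \forall i \near F, vnorm (l - x i) < e.
Proof.
split=> [/cvgrPdist_lt xl e e0|xl].
  have e0' : 0 < e%:C by rewrite ltcR.
  by apply: filterS (xl _ e0') => i; rewrite vnormE ltcR.
apply/cvgrPdist_lt => _ /normC_gt0P[e e0 ->].
by apply: filterS (xl _ e0) => i; rewrite vnormE ltcR.
Qed.

Lemma vnorm_cauchyP (F : set_system V) {FF : ProperFilter F} :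
  cauchy F <-> forall e : R, 0 < e -> exists x, \forall y \near F, vnorm (x - y) < e.
Proof.
split=> [/cauchyP Fc e e0|Fc].
  have /Fc[x Fx] : 0 < e%:C by rewrite ltcR.
  by exists x; apply: filterS Fx => y; rewrite -ball_normE/= vnormE ltcR.
apply: cauchy_exP => _ /normC_gt0P[e /Fc[x Fx] ->].
by exists x; apply: filterS Fx => y; rewrite -ball_normE/= vnormE ltcR.
Qed.

(** Closed balls of M_n(V) are closed under entrywise convergence: the entry bound makes l - x_i
    small in matrix norm. *)
Lemma mxnorm_cvg_le (I : Type) (F : set_system I) {FF : ProperFilter F} n
    (x : I -> 'M[V]_n) (l : 'M[V]_n) (M : R) :
  (forall p q, x i p q @[i --> F] --> l p q) ->
  (\forall i \near F, mxnorm (x i) <= M) -> mxnorm l <= M.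
Proof.
move=> xl xM; apply/ler_addgt0Pr => e e0.
(* There are n * n entries to share e; the successor keeps the divisor positive when n = 0. *)
have d0 : 0 < e / (n * n).+1%:R by rewrite divr_gt0.
have : \forall i \near F, forall pq : 'I_n * 'I_n,
    vnorm (l pq.1 pq.2 - x i pq.1 pq.2) < e / (n * n).+1%:R.
  by apply: filter_forall => -[p q]; have /vnorm_cvgP := xl p q; apply.
move=> /(filterI xM)/filter_ex[i [xiM xil]].
have -> : l = x i + (l - x i) by rewrite addrC subrK.
rewrite (le_trans (ler_mxnormD _ _))// lerD// (le_trans (mxnorm_entry_le _))//.
apply: (@le_trans _ _ (\sum_(p < n) \sum_(q < n) e / (n * n).+1%:R)).
  by apply: ler_sum => p _; apply: ler_sum => q _; rewrite !mxE; exact: ltW (xil (p, q)).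
rewrite !sumr_const !card_ord -mulrnA -[leLHS]mulr_natr -[leLHS]mulrA.
by rewrite ler_piMr ?(ltW e0)// mulrC ler_pdivrMr// mul1r ler_nat.
Qed.

Lemma vnorm_cvg_le (I : Type) (F : set_system I) {FF : ProperFilter F}
    (x : I -> V) (l : V) (M : R) :
  x i @[i --> F] --> l -> (\forall i \near F, vnorm (x i) <= M) -> vnorm l <= M.
Proof.
move=> xl xM; apply: (@mxnorm_cvg_le _ F _ _ (fun i => const_mx (x i))) => //.
by move=> p q; rewrite mxE; under eq_fun do rewrite mxE.
Qed.

End Convergence.

(** * Completeness of the scalars and of dual spaces *)

Lemma vnormC (R : realType) (z : R[i]^o) : vnorm z = normc z.
Proof. by apply/complexI; rewrite -vnormE. Qed.

Lemma complex_complete (R : realType) (F : set_system R[i]^o) :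
  ProperFilter F -> cauchy F -> cvg F.
Proof.
move=> FF /vnorm_cauchyP Fc.
(* Any 1-Lipschitz real function of z converges along F; this is applied to the real and imaginary
   parts. *)
have cmp (p : R[i] -> R) : (forall z w, `|p z - p w| <= normc (z - w)) ->
    exists a : R, p z @[z --> F] --> a.
  move=> pE; suff /cvg_ex : cvg (p z @[z --> F]) by [].
  apply: cauchy_cvg; apply: cauchy_exP => e /Fc[z Fz]; exists (p z).
  apply: filterS Fz => w; rewrite vnormC -ball_normE/=.
  exact: le_lt_trans (pE _ _).
have sqrt_le (a b : R) : `|a| <= Num.sqrt (a ^+ 2 + b ^+ 2).
  by rewrite -sqrtr_sqr ler_wsqrtr// lerDl sqr_ge0.
have [|a Fa] := cmp (@complex.Re R); first by move=> [x y] [x' y'] /=; exact: sqrt_le.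
have [|b Fb] := cmp (@complex.Im R).
  by move=> [x y] [x' y']; rewrite /= [X in Num.sqrt X]addrC; exact: sqrt_le.
apply/cvg_ex; exists (a +i* b); apply/(@vnorm_cvgP R R[i]^o _ _ _ id) => e e0.
have e20 : 0 < e / 2 by rewrite divr_gt0.
have /cvgrPdist_lt/(_ _ e20) Fa' := Fa; have /cvgrPdist_lt/(_ _ e20) Fb' := Fb.
apply: filterS2 Fa' Fb' => z /= az bz; rewrite vnormC.
have -> : a +i* b - z = (a - complex.Re z)%:C + (0 +i* (b - complex.Im z)).
  by case: z {az bz} => x y; apply/eqP; rewrite eq_complex/= add0r addr0 !eqxx.
rewrite (le_lt_trans (normcD _ _))// normcR [e]splitr ltrD//.
by rewrite /= expr0n add0r sqrtr_sqr.
Qed.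

Section DualComplete.
Variables (R : realType) (V : operatorSpaceType R).

Lemma dual_eval_cvg (I : Type) (F : set_system I) {FF : Filter F} (f : dual V)
    (x : I -> V) (l : V) :
  x i @[i --> F] --> l -> f (x i) @[i --> F] --> f l.
Proof. by move=> xl; apply: cvg_comp xl _; exact: dual_continuous. Qed.

Lemma dual_linB (f : dual V) x y : f (x - y) = f x - f y.
Proof. exact: linear_subr (dual_lin f) x y. Qed.

(** The limit g is built pointwise; the Cauchy estimates are uniform on bounded sets, which makes g
    bounded and the convergence one in norm. *)
Lemma dual_complete (F : set_system (dual V)) : ProperFilter F -> cauchy F -> cvg F.
Proof.
move=> FF /vnorm_cauchyP Fc.
have Fv (v : V) : exists z : R[i]^o, (fun f : dual V => f v) @ F --> z.
  suff /cvg_ex : cvg ((fun f : dual V => f v) @ F) by [].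
  apply: complex_complete; apply/vnorm_cauchyP => e e0.
  have [|f Ff] := Fc (e / (vnorm v + 1)); first by rewrite divr_gt0// ltr_wpDl ?vnorm_ge0.
  exists (f v).
  suff : F [set g : dual V | normc (f v - g v) < e].
    move=> FA; rewrite near_map; apply: (@filterS _ F _ _ _ _ FA) => g /=.
    by rewrite -vnormC.
  apply: (@filterS _ F _ _ _ _ Ff) => g fg /=.
  have := dual_normP (f - g) v; rewrite -[(f - g) v]/(f v - g v) => h.
  rewrite (le_lt_trans h)//.
  rewrite (@le_lt_trans _ _ (vnorm (f - g) * (vnorm v + 1)))//.
    by rewrite ler_wpM2l ?vnorm_ge0// lerDl.
  by rewrite -ltr_pdivlMr// ltr_wpDl ?vnorm_ge0.
have [g gP] := choice Fv.
have lg : linear g.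
  move=> c x y.
  have h : (fun f : dual V => f (c *: x + y)) @ F --> (c *: g x + g y : R[i]^o).
    rewrite (_ : (fun f : dual V => f (c *: x + y)) = (fun f => c *: f x + f y)).
      by apply: cvgD; [apply: cvgZr; exact: gP|exact: gP].
    by apply/funext => f; exact: dual_lin.
  exact: (cvg_unique _ (gP _) h).
(* The bound on f v - f' v has the same e for all v, so it survives the pointwise limit of f' to
   g. *)
have gd (e : R) f : 0 <= e -> (\forall f' \near F, vnorm (f - f') < e) ->
    forall v, normc (f v - g v) <= e * vnorm v.
  move=> e0 Ff v; rewrite -vnormC.
  apply: (@vnorm_cvg_le R R[i]^o _ F _ (fun f' : dual V => f v - f' v)).
    by apply: cvgB; [exact: cvg_cst|exact: gP].
  apply: filterS Ff => f' ff'; rewrite vnormC.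
  have := dual_normP (f - f') v; rewrite -[(f - f') v]/(f v - f' v) => h.
  by rewrite (le_trans h)// ler_wpM2r ?vnorm_ge0// ltW.
have gdual : g \in @dual_pred R V.
  (* One functional within distance 1 of F-almost all others already bounds g. *)
  have [f1 Ff1] := Fc 1 ltr01.
  apply: (@bounded_dual _ _ _ (vnorm f1 + 1)) => // v.
  rewrite -[g v](subrKC (f1 v)) -opprB.
  rewrite (le_trans (normcD _ _))// mulrDl lerD ?dual_normP//.
  by rewrite normcN; exact: gd Ff1 v.
apply/cvg_ex; exists (Dual gdual); apply/(@vnorm_cvgP R (dual V) _ _ _ id) => e e0.
have e20 : 0 < e / 2 by rewrite divr_gt0.
have [f Ff] := Fc _ e20; apply: filterS (Ff) => f' ff' /=.
have fg : vnorm (f - Dual gdual) <= e / 2.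
  by apply: dual_norm_le => [|v]; [exact: ltW|exact: gd (ltW e20) Ff v].
rewrite vnorm_distC in fg.
have -> : Dual gdual - f' = (Dual gdual - f) + (f - f') by rewrite addrA subrK.
apply: le_lt_trans (vnormD _ _) _.
by rewrite [e]splitr; exact: ler_ltD fg ff'.
Qed.

End DualComplete.

(** * Density arguments and completeness for LUC(A') *)

Section LucDensity.
Variables (R : realType) (A : ccBanachAlgType R).

Lemma luc_val_linear c (f g : luc A) :
  luc_val (c *: f + g) = c *: luc_val f + luc_val g.
Proof. by []. Qed.

Lemma luc_valB (f g : luc A) : luc_val (f - g) = luc_val f - luc_val g.
Proof. by []. Qed.

(** Induction form of density: a norm-closed subspace containing every f . a is all of LUC(A'). It
    avoids any appeal to the factorization LUC(A') = A' . A. *)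
Lemma luc_ind (P : luc A -> Prop) :
  (forall f a, P (luc_act f a)) ->
  (forall c f g, P f -> P g -> P (c *: f + g)) ->
  (forall f, (forall e : R, 0 < e -> exists2 g, P g & vnorm (f - g) < e) -> P f) ->
  forall f, P f.
Proof.
move=> Pact Plin Pcl f; apply: Pcl => e e0.
(* The sum induction below starts at the empty sum, and 0 is itself of the form f . a. *)
have P0 : P 0.
  have -> : 0 = luc_act (0 : dual A) 0 :> luc A by apply/val_inj/val_inj/funext.
  exact: Pact.
have /asboolP := valP f.
have e0' : 0 < e%:C by rewrite ltcR.
move=> /(_ _ (nbhsx_ballx (luc_val f) _ e0'))[_ [[n [c [s [sS ->]]]]]].
rewrite -ball_normE/= vnormE ltcR => fse.
have [g Pg gE] : exists2 g, P g & luc_val g = \sum_i c i *: s i.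
  elim/big_ind : _ => [|u v [f1 Pf1 <-] [f2 Pf2 <-]|i _]; first by exists 0.
    exists (f1 + f2) => //; rewrite -[f1]scale1r; exact: Plin.
  have [h _ [a _ <-]] := sS i; exists (c i *: luc_act h a) => //.
  by rewrite -[_ *: _]addr0; exact: Plin.
exists g; first exact: Pg.
rewrite vnorm_luc luc_valB gE; exact: fse.
Qed.

Lemma luc_dual_ext (mu nu : dual (luc A)) :
  (forall f a, mu (luc_act f a) = nu (luc_act f a)) -> mu = nu.
Proof.
move=> munu; apply/val_inj/funext; apply: luc_ind => // [c f g /= hf hg|f hf /=].
  by rewrite !dual_lin hf hg.
apply/eqP; rewrite -subr_eq0 -normr_eq0 normCE; apply/eqP; congr (_%:C).
apply/eqP; rewrite eq_le normc_ge0 andbT; apply/ler_addgt0Pr => e e0; rewrite add0r.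
have d0 : 0 < vnorm (mu - nu) + 1 by rewrite ltr_wpDl ?vnorm_ge0.
have [|g /= hg fg] := hf (e / (vnorm (mu - nu) + 1)); first by rewrite divr_gt0.
have -> : mu f - nu f = (mu - nu) (f - g).
  by rewrite -[RHS]/(mu (f - g) - nu (f - g)) !dual_linB hg opprB addrA subrK.
rewrite (le_trans (dual_normP _ _))//.
rewrite (@le_trans _ _ ((vnorm (mu - nu) + 1) * vnorm (f - g)))//.
  by rewrite ler_wpM2r ?vnorm_ge0// lerDl.
by rewrite mulrC -ler_pdivlMr// ltW.
Qed.

(** LUC(A') is a closed subspace of the complete space A'. *)
Lemma luc_cauchy_cvg (phi : nat -> luc A) :
  (forall e : R, 0 < e -> exists N, forall m n, (N <= m)%N -> (N <= n)%N ->
    vnorm (phi m - phi n) < e) ->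
  exists l : luc A, phi n @[n --> \oo] --> l.
Proof.
move=> phiC.
have /cvg_ex[/= l phil] : cvg (luc_val (phi n) @[n --> \oo]).
  apply: dual_complete; apply/vnorm_cauchyP => e /phiC[N phiN].
  exists (luc_val (phi N)); rewrite near_map; exists N => // n /= Nn.
  by rewrite -luc_valB -vnorm_luc phiN.
have lP : l \in @luc_pred R A.
  apply/asboolP; set S := linear_span _.
  apply: (@closed_cvg _ _ _ _ (fun n => luc_val (phi n)) (closure S) _ _ _ phil).
    exact: closed_closure.
  by apply: nearW => n; have /asboolP := valP (phi n).
exists (LUC lP); apply/vnorm_cvgP => e e0.
have /vnorm_cvgP/(_ e e0) := phil.
by apply: filterS => n; rewrite vnorm_luc.
Qed.

End LucDensity.

(** * The approximate identity and the functional of a module map *)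

Section ApproximateIdentity.
Variables (R : realType) (A : ccBanachAlgType R).
Variables (I : Type) (G : set_system I) (e : I -> A).
Context {FG : ProperFilter G}.
Hypothesis e_le1 : forall i, vnorm (e i) <= 1.
Hypothesis e_cvg : forall a, amul a (e i) @[i --> G] --> a.

Lemma vnorm_luc_act (f : dual A) (a : A) : vnorm (luc_act f a) <= vnorm f * vnorm a.
Proof. by rewrite vnorm_luc vnorm_dual_act. Qed.

(** On generators, (f . a) . e_i = f . (a e_i) tends to f . a. The bound |e_i| <= 1 makes the
    actions of the e_i uniformly contractive, so convergence passes to the closure. *)
Lemma luc_act_approx (f : luc A) : luc_act f (e i) @[i --> G] --> f.
Proof.
elim/luc_ind: f => [f a|c f g hf hg|f hf].
- apply/vnorm_cvgP => d d0.
  have d0' : 0 < d / (vnorm f + 1) by rewrite divr_gt0// ltr_wpDl ?vnorm_ge0.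
  have /vnorm_cvgP/(_ _ d0') := @e_cvg a; apply: filterS => i.
  have -> : luc_act f a - luc_act (luc_act f a) (e i) = luc_act f (a - amul a (e i)).
    rewrite (linear_subr (@luc_act_linr _ _ f)); congr (_ - _).
    by apply/val_inj; exact: dual_actA.
  rewrite ltr_pdivlMr ?ltr_wpDl ?vnorm_ge0// => h.
  apply: le_lt_trans h; rewrite (le_trans (vnorm_luc_act _ _))// mulrC.
  by rewrite ler_wpM2l ?vnorm_ge0// lerDl.
- have -> : (fun i => luc_act (c *: f + g) (e i)) =
      (fun i => c *: luc_act f (e i) + luc_act g (e i)).
    by apply/funext => i; exact: luc_act_linl.
  by apply: cvgD => //; exact: cvgZr.
apply/vnorm_cvgP => d d0; have d30 : 0 < d / 3 by rewrite divr_gt0.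
have [g /vnorm_cvgP/(_ _ d30) hg fg] := hf _ d30.
apply: filterS hg => i hg.
have -> : f - luc_act f (e i) = (f - g) + (g - luc_act g (e i)) + luc_act (g - f) (e i).
  have -> : luc_act (g - f) (e i) = luc_act g (e i) - luc_act f (e i).
    exact: (linear_subr (@luc_act_linl R A (e i)) (luc_val g) (luc_val f)).
  by rewrite !addrA !subrK.
have h : vnorm (luc_act (g - f) (e i)) < d / 3.
  have gf : vnorm (luc_val (g - f)) < d / 3.
    by rewrite -vnorm_luc vnorm_distC; exact: fg.
  apply: le_lt_trans (vnorm_luc_act _ _) _; apply: le_lt_trans gf.
  by apply: ler_piMr; [exact: vnorm_ge0|exact: e_le1].
apply: le_lt_trans (vnormD _ _) _.
have -> : d = d / 3 + d / 3 + d / 3 by field.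
refine (ltrD _ h); apply: le_lt_trans (vnormD _ _) _; exact: (ltrD fg hg).
Qed.

Lemma vnorm_cbmodE (T : cbmod A) : vnorm T = vnorm (cbmod_val T).
Proof.
by rewrite /vnorm -[LHS]/(cbmod_norm _); congr mxnorm; apply/matrixP => i j; rewrite !mxE.
Qed.

Lemma vnorm_cbmod (T : cbmod A) f : vnorm (T f) <= vnorm T * vnorm f.
Proof.
have := mxnorm_app_cbmap (const_mx (cbmod_val T) : 'M_1) (const_mx f : 'M_1).
rewrite mxkron_const1 mxnorm_cast mxnormE1 mxE mxE vnorm_cbmodE; exact.
Qed.

Lemma vnorm_cbmod_approx (T : cbmod A) f i :
  normc (T f (e i)) <= vnorm T * vnorm f.
Proof.
rewrite (le_trans (dual_normP _ _))// -[leRHS]mulr1.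
by rewrite ler_pM ?vnorm_ge0// vnorm_cbmod.
Qed.

Lemma cbmod_lin (T : cbmod A) c f g : T (c *: f + g) = c *: T f + T g.
Proof. exact: cbmap_lin. Qed.

Lemma cbmod_act (T : cbmod A) f a : T (dual_act f a) = dual_act (T f) a.
Proof. by have /asboolP := valP T. Qed.

(** At f . a the net is (T f)(a e_i), with limit (T f)(a). Defining mu by a limit, not by its values
    on generators, makes well-definedness automatic. *)
Lemma cbmod_functional (T : cbmod A) :
  exists mu : dual (luc A), forall f : luc A, T f (e i) @[i --> G] --> mu f.
Proof.
have ex (f : luc A) : exists z : R[i]^o, T f (e i) @[i --> G] --> z.
  elim/luc_ind: f => [f a|c f g [x fx] [y gy]|f hf].
  - exists (T f a); rewrite /= cbmod_act.
    exact: dual_eval_cvg.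
  - exists (c *: x + y).
    have -> : (fun i => T (c *: f + g : luc A) (e i)) =
        (fun i => c *: T f (e i) + T g (e i)).
      by apply/funext => i; rewrite luc_val_linear cbmod_lin.
    by apply: cvgD; [apply: cvgZr; exact: fx|exact: gy].
  - apply/cvg_ex; apply: complex_complete; apply/vnorm_cauchyP => d d0.
    have d20 : 0 < d / 2 by rewrite divr_gt0.
    have T0 : 0 < vnorm T + 1 by rewrite ltr_wpDl ?vnorm_ge0.
    have [|g [x gx] fg] := hf (d / 2 / (vnorm T + 1)); first by rewrite divr_gt0.
    (* The Cauchy criterion only asks for a centre: the limit x belonging to the nearby g serves, as
       T (g - f) at e_i is bounded uniformly in i. *)
    exists x; rewrite near_map; have /vnorm_cvgP/(_ _ d20) := gx.
    apply: filterS => i xi.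
    have -> : x - T f (e i) = (x - T g (e i)) + T (g - f : luc A) (e i) :> R[i]^o.
      rewrite luc_valB (linear_subr (@cbmap_lin _ _ _ T)).
      by rewrite -[(T g - T f) (e i)]/(T g (e i) - T f (e i)) addrA subrK.
    apply: le_lt_trans (vnormD _ _) _; rewrite [d]splitr; refine (ltr_leD xi _).
    rewrite vnormC; apply: le_trans (vnorm_cbmod_approx _ _ _) _.
    rewrite -vnorm_luc vnorm_distC.
    apply: (@le_trans _ _ ((vnorm T + 1) * vnorm (f - g))).
      by apply: ler_wpM2r; [exact: vnorm_ge0|rewrite lerDl].
    by rewrite mulrC -ler_pdivlMr//; exact: ltW fg.
have [mu muP] := choice ex.
have mu_dual : mu \in @dual_pred R (luc A).
  apply: (@bounded_dual _ _ _ (vnorm T)) => [c f g|f].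
    have h : (fun i => T (c *: f + g : luc A) (e i)) @ G --> (c *: mu f + mu g : R[i]^o).
      have -> : (fun i => T (c *: f + g : luc A) (e i)) =
          (fun i => c *: T f (e i) + T g (e i)).
        by apply/funext => i; rewrite luc_val_linear cbmod_lin.
      by apply: cvgD; [apply: cvgZr|]; exact: muP.
    exact: (cvg_unique _ (muP _) h).
  rewrite -vnormC; apply: (vnorm_cvg_le (muP f)); apply: nearW => i.
  by rewrite vnormC vnorm_luc vnorm_cbmod_approx.
by exists (Dual mu_dual).
Qed.

Lemma cbmod_functional_act (T : cbmod A) (mu : dual (luc A)) :
  (forall f : luc A, T f (e i) @[i --> G] --> mu f) ->
  forall f a, mu (luc_act f a) = T f a.
Proof.
move=> muP f a.
have h : T (dual_act f a) (e i) @[i --> G] --> T f a.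
  by rewrite cbmod_act; exact: dual_eval_cvg.
exact: (cvg_unique _ (muP (luc_act f a)) h).
Qed.

Lemma mxnorm_eval n (F : 'M[dual A]_n) (a : A) :
  mxnorm (map_mx (fun f : dual A => f a) F : 'M[R[i]^o]_n) <= mxnorm F * vnorm a.
Proof.
have := mxnorm_app_dual F (const_mx a : 'M_1); congr (_ <= _).
rewrite -(mxnorm_cast (muln1 n, muln1 n)); congr mxnorm.
apply/matrixP => p q; rewrite castmxE/= !mxE; congr (F _ _ a);
  by apply: val_inj; rewrite /= divn1.
Qed.

(** The matrix mu(x) is the entrywise limit of T(x) evaluated at e_i, and evaluation at a vector of
    norm at most 1 is completely contractive. *)
Lemma mxnorm_cbmod_functional n (T : 'M[cbmod A]_n) (mu : 'M[dual (luc A)]_n) :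
  (forall p q (f : luc A), T p q f (e i) @[i --> G] --> mu p q f) ->
  mxnorm mu <= mxnorm T.
Proof.
move=> muP; apply: mxnorm_dual_le => [|m x]; first exact: mxnorm_ge0.
pose y := mxkron (fun (S : cbmod A) (f : luc A) => S f) T x.
apply: (@mxnorm_cvg_le R R[i]^o I G _ _
  (fun i => map_mx (fun f : dual A => f (e i)) y)).
  move=> p q; rewrite [X in _ --> X]mxE.
  under eq_fun do rewrite 2!mxE; exact: muP.
apply: nearW => i; rewrite (le_trans (mxnorm_eval _ _))//.
rewrite (@le_trans _ _ (mxnorm y))//; first by rewrite ler_piMr ?mxnorm_ge0.
have -> : y = mxkron (fun (S : cbmap (dual A) (dual A)) f => S f)
    (map_mx (@cbmod_val R A) T) (map_mx (@luc_val R A) x).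
  by apply/matrixP => p q; rewrite !mxE.
exact: mxnorm_app_cbmap.
Qed.

(** The hypothesis says that T f = mu [] f, and [lmul_dual] is jointly completely contractive. *)
Lemma mxnorm_cbmod_le n (T : 'M[cbmod A]_n) (mu : 'M[dual (luc A)]_n) :
  (forall p q f a, mu p q (luc_act f a) = T p q f a) -> mxnorm T <= mxnorm mu.
Proof.
move=> muT; rewrite -[mxnorm T]/(mxnorm (map_mx (@cbmod_val R A) T)).
apply: mxnorm_cbmap_le => [|m x]; first exact: mxnorm_ge0.
have -> : mxkron (fun (S : cbmap (dual A) (dual A)) f => S f)
    (map_mx (@cbmod_val R A) T) x = mxkron (@lmul_dual R A) mu x.
  by apply/matrixP => p q; rewrite !mxE; apply/val_inj/funext => a /=; rewrite muT.
exact: mxnorm_lmul_dual.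
Qed.

End ApproximateIdentity.

(** * The operator space projective norm *)

Section ProjectiveNorm.
Variables (R : realType) (V W : operatorSpaceType R).
Notation C := R[i].
Notation et := (@elem_tensor R V W).

Lemma alg_tensorB u u' : alg_tensor u -> alg_tensor u' ->
  @alg_tensor R V W (u - u').
Proof.
by move=> tu tu'; rewrite addrC -scaleN1r; exact: span_subspace.
Qed.

Lemma elem_tensorZl c v w : et (c *: v) w = c *: et v w.
Proof. by apply/funext => B; exact: (linear_scaler (bilin_linl B w)). Qed.

Lemma elem_tensorZr c v w : et v (c *: w) = c *: et v w.
Proof. by apply/funext => B; exact: (linear_scaler (bilin_linr B v)). Qed.

Lemma elem_tensor0l w : et 0 w = 0.
Proof. by rewrite -(scale0r 0) elem_tensorZl scale0r. Qed.

Lemma alg_tensor_sum u : alg_tensor u ->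
  exists n (v : 'I_n -> V) (w : 'I_n -> W), u = \sum_i et (v i) (w i).
Proof.
move=> [n [c [s [sS ->]]]].
have /choice[vw vwP] (i : 'I_n) : exists vw : V * W, s i = et vw.1 vw.2.
  by have [v _ [w _ <-]] := sS i; exists (v, w).
exists n, (fun i => c i *: (vw i).1), (fun i => (vw i).2).
by apply: eq_bigr => i _; rewrite elem_tensorZl vwP.
Qed.

Definition family_diag (U : operatorSpaceType R) n (v : 'I_n -> U) : 'M[U]_n :=
  \matrix_(i, j) if i == j then v i else 0.

Lemma mxnorm_family_diag (U : operatorSpaceType R) n (v : 'I_n -> U) (K : R) :
  0 <= K -> (forall i, vnorm (v i) <= K) -> mxnorm (family_diag v) <= K.
Proof.
move=> K0; elim: n v => [|n IH] v vK.
  by rewrite (_ : family_diag v = 0) ?mxnorm0//; apply/matrixP => -[].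
have -> : family_diag v = block_mx (const_mx (v ord0) : 'M_1) 0 0
    (family_diag (fun i : 'I_n => v (lift ord0 i))) :> 'M_(1 + n).
  apply/matrixP => i j; rewrite mxE.
  case: (split_ordP i) => i' ->; case: (split_ordP j) => j' ->.
  - by rewrite block_mxEul mxE !ord1 eqxx; congr v; apply: val_inj.
  - by rewrite block_mxEur mxE -val_eqE/= (ord1 i').
  - by rewrite block_mxEdl mxE -val_eqE/= (ord1 j').
  - rewrite block_mxEdr mxE -val_eqE/= eqn_add2l val_eqE.
    by case: eqP => // _; congr v; apply: val_inj.
rewrite [leLHS](mxnorm_dsum (const_mx (v ord0) : 'M_1)) ge_max; apply/andP; split.
  exact: vK.
by apply: IH => i; exact: vK.
Qed.

Lemma big_mxtens_diag (M : nmodType) n (g : 'I_(n * n) -> M) :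
  (forall i j, i != j -> g (mxtens_index (i, j)) = 0) ->
  \sum_p g p = \sum_i g (mxtens_index (i, i)).
Proof.
move=> g0; rewrite (reindex (@mxtens_index n n))/=; last first.
  by exists (@mxtens_unindex n n) => ? _; rewrite (mxtens_indexK, mxtens_unindexK).
rewrite (eq_bigr (fun p => g (mxtens_index (p.1, p.2)))); last by case.
rewrite -(pair_bigA _ (fun p q => g (mxtens_index (p, q))))/=.
apply: eq_bigr => i _; rewrite (bigD1 i)//= big1 ?addr0// => j ji.
by rewrite g0// eq_sym.
Qed.

(** The vector sum_i r_i e_i (x) e_i of C^n (x) C^n. *)
Definition diag_col n (r : 'I_n -> R) : 'cV[C]_(n * n) :=
  \col_p if (mxtens_unindex p).1 == (mxtens_unindex p).2
         then (r (mxtens_unindex p).1)%:C else 0.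

Lemma diag_col_index n (r : 'I_n -> R) i j :
  diag_col r (mxtens_index (i, j)) 0 = if i == j then (r i)%:C else 0.
Proof. by rewrite mxE !mxtens_indexK. Qed.

Lemma l2norm_diag_col n (r : 'I_n -> R) :
  l2norm (diag_col r) = Num.sqrt (\sum_i r i ^+ 2).
Proof.
congr Num.sqrt; rewrite big_mxtens_diag => [|i j ij].
  by apply: eq_bigr => i _; rewrite diag_col_index eqxx normcR real_normK ?num_real.
by rewrite diag_col_index (negbTE ij) normc0 expr0n.
Qed.

(** The Kronecker product of two diagonal matrices is diagonal with v_i (x) w_k at position (i, k);
    compressing it by [diag_col r] selects i = k with weight r_i^2. *)
Lemma elem_tensor_factor n (r : 'I_n -> R) (v : 'I_n -> V) (w : 'I_n -> W) :
  const_mx (\sum_i (r i ^+ 2)%:C *: et (v i) (w i)) =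
  mxact (\row_p (diag_col r p 0)^*%C)
    (mxkron et (family_diag v) (family_diag w)) (diag_col r) :> 'M_1.
Proof.
apply/matrixP => p q; rewrite [LHS]mxE [RHS]mxE big_mxtens_diag => [|i j ij].
  apply: eq_bigr => i _; rewrite (bigD1 (mxtens_index (i, i)))//= big1 => [|k].
    rewrite addr0 !ord1 [in RHS]mxE diag_col_index eqxx conjc_real -rmorphM/= -expr2.
    by congr (_ *: _); rewrite !mxE !mxtens_indexK/= !eqxx.
  rewrite !ord1; case: (mxtens_indexP k) => j l.
  rewrite [in X in _ -> X]mxE !diag_col_index.
  case: (eqVneq j l) => [->|_] ki; last by rewrite mulr0 scale0r.
  have il : (i == l) = false by apply: contra_neqF ki => /eqP->.
  rewrite [X in _ *: X]mxE !mxtens_indexK/= !mxE il.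
  by rewrite elem_tensor0l scaler0.
apply: big1 => k _; rewrite [X in X * _]mxE diag_col_index (negbTE ij).
by rewrite conjc0 mul0r scale0r.
Qed.

Lemma proj_norm_lbound n (u : 'M[bilin V W -> C^o]_n) :
  has_lbound [set r | exists p q (a : 'M[C]_(n, p * q)) (v : 'M[V]_p) (w : 'M[W]_q)
                 (b : 'M[C]_(p * q, n)),
         u = mxact a (mxkron et v w) b /\
         r = opnorm a * mxnorm v * mxnorm w * opnorm b].
Proof.
exists 0 => _ [p [q [a [v [w [b [_ ->]]]]]]].
by rewrite !mulr_ge0 ?opnorm_ge0 ?mxnorm_ge0.
Qed.

(** The operator space projective norm is at most the Banach space one. Normalize v_i and w_i and
    put r_i^2 = |v_i| |w_i|: the diagonal matrices become contractions and the two outer factors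
    contribute sum_i r_i^2. *)
Lemma proj_norm_sum n (v : 'I_n -> V) (w : 'I_n -> W) :
  proj_norm (const_mx (\sum_i et (v i) (w i)) : 'M_1) <=
  \sum_i vnorm (v i) * vnorm (w i).
Proof.
pose q i := vnorm (v i) * vnorm (w i).
have q0 i : 0 <= q i by rewrite mulr_ge0 ?vnorm_ge0.
(* As the inverse of 0 is 0, [unit] sends 0 to 0 and no case distinction is needed afterwards. *)
pose unit (U : operatorSpaceType R) (x : U) := ((vnorm x)^-1)%:C *: x.
have unitE (U : operatorSpaceType R) (x : U) : x = (vnorm x)%:C *: unit U x.
  rewrite /unit scalerA -rmorphM/=; have [x0|x0] := eqVneq (vnorm x) 0.
    by rewrite (vnorm_eq0 x0) scaler0.
  by rewrite mulfV// rmorph1 scale1r.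
have unit1 (U : operatorSpaceType R) (x : U) : vnorm (unit U x) <= 1.
  rewrite /unit vnormZ normcR ger0_norm ?invr_ge0 ?vnorm_ge0//.
  by have [->|x0] := eqVneq (vnorm x) 0; rewrite ?mulr0// mulVf.
have -> : \sum_i et (v i) (w i) =
    \sum_i (Num.sqrt (q i) ^+ 2)%:C *: et (unit V (v i)) (unit W (w i)).
  apply: eq_bigr => i _; rewrite {1}[v i]unitE {1}[w i]unitE.
  by rewrite elem_tensorZl elem_tensorZr scalerA sqr_sqrtr// rmorphM.
rewrite elem_tensor_factor; set r := fun i => Num.sqrt (q i).
apply: (@le_trans _ _ (l2norm (diag_col r) * 1 * 1 * l2norm (diag_col r))).
  set a := \row_p _; set b := diag_col r.
  set v' := family_diag _; set w' := family_diag _.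
  apply: (@le_trans _ _ (opnorm a * mxnorm v' * mxnorm w' * opnorm b)).
    by apply: ge_inf; [exact: proj_norm_lbound|exists n, n, a, v', w', b].
  have v1 : mxnorm v' <= 1 by apply: mxnorm_family_diag => // i; exact: unit1.
  have w1 : mxnorm w' <= 1 by apply: mxnorm_family_diag => // i; exact: unit1.
  by rewrite !ler_pM ?mulr_ge0 ?opnorm_ge0 ?mxnorm_ge0 ?opnorm_row ?opnorm_col.
rewrite !mulr1 -expr2 l2norm_diag_col sqr_sqrtr; last first.
  by rewrite sumr_ge0// => i _; rewrite sqr_ge0.
by apply: ler_sum => i _; rewrite sqr_sqrtr.
Qed.

Lemma proj_norm_lt u (e : R) : alg_tensor u ->
  proj_norm (const_mx u : 'M_1) < e ->
  exists p q (a : 'M[C]_(1, p * q)) (v : 'M[V]_p) (w : 'M[W]_q) (b : 'M[C]_(p * q, 1)),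
    const_mx u = mxact a (mxkron et v w) b /\
    opnorm a * mxnorm v * mxnorm w * opnorm b < e.
Proof.
move=> /alg_tensor_sum[n [v [w uE]]] /inf_lt[|r].
  (* An infimum below e yields a factorization only if some factorization exists; the diagonal one
     with all weights 1 shows that. *)
  eexists; exists n, n, (\row_p (diag_col (fun=> 1) p 0)^*%C), (family_diag v),
    (family_diag w), (diag_col (fun=> 1)); split; last reflexivity.
  rewrite -elem_tensor_factor uE; congr const_mx.
  by apply: eq_bigr => i _; rewrite expr1n scale1r.
by move=> [p [q [a [v' [w' [b [h ->]]]]]]] lte; exists p, q, a, v', w', b.
Qed.

Lemma cb_pairingP (T : cbmap V (dual W)) (u : ptensor V W) (l : C^o) :
  u n (cb_bilin T) @[n --> \oo] --> l -> cb_pairing T u = l.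
Proof. by move=> ul; apply: cvg_lim ul; exact: norm_hausdorff. Qed.

Lemma proj_norm_elem_diff0 (v : V) (w : W) (e : R) : 0 < e ->
  exists N, forall m n : nat, (N <= m)%N -> (N <= n)%N ->
    proj_norm (const_mx (et v w - et v w) : 'M_1) < e.
Proof.
move=> e0; exists 0%N => _ _ _ _; rewrite subrr.
(* The zero tensor is the empty sum, so its norm is bounded by an empty sum. *)
have := @proj_norm_sum 0 (fun=> 0) (fun=> 0); rewrite !big_ord0 => h.
exact: le_lt_trans h e0.
Qed.

Definition elem_ptensor (v : V) (w : W) : ptensor V W :=
  PTensor (ptensor_seq := fun=> et v w)
    (fun=> span_sub (ex_intro2 _ _ v I (ex_intro2 _ _ w I erefl)))
    (proj_norm_elem_diff0 v w).

Lemma cb_pairing_elem (T : cbmap V (dual W)) v w :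
  cb_pairing T (elem_ptensor v w) = T v w.
Proof. by apply: cb_pairingP; exact: cvg_cst. Qed.

End ProjectiveNorm.

(** * From tensors in A' (x) A to LUC(A') and back *)

Lemma geometric_small (R : realType) (c e : R) : 0 <= c -> 0 < e ->
  exists N, forall m, (N <= m)%N -> c * 2^-1 ^+ m < e.
Proof.
move=> c0 e0; exists (Num.bound (c / e)) => m Nm.
have h : c / e < 2 ^+ m.
  rewrite (lt_le_trans (archi_boundP _)) ?divr_ge0 ?(ltW e0)//.
  rewrite -natrX ler_nat (leq_trans Nm)// ltnW// ltn_expl//.
by rewrite exprVn ltr_pdivrMr ?exprn_gt0// mulrC -ltr_pdivrMr.
Qed.

Section LucTensors.
Variables (R : realType) (A : ccBanachAlgType R).
Notation et := (@elem_tensor R (dual A) A).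

Lemma dual_sumE (V : operatorSpaceType R) (I : finType) (f : I -> dual V) x :
  (\sum_i f i) x = \sum_i f i x.
Proof. by elim/big_rec2 : _ => // i y z _ <-. Qed.

Lemma bilin_sumE (V W : operatorSpaceType R) (I : finType)
    (u : I -> bilin V W -> R[i]^o) B : (\sum_i u i) B = \sum_i u i B.
Proof. by elim/big_rec2 : _ => // i y z _ <-. Qed.

Lemma functional_sum (V : operatorSpaceType R) (f : dual V) (I : finType) (x : I -> V) :
  f (\sum_i x i) = \sum_i f (x i).
Proof.
have [F FE] := linear_ex (dual_lin f).
by rewrite FE linear_sum.
Qed.

Lemma luc_val_sum (I : finType) (x : I -> luc A) :
  luc_val (\sum_i x i) = \sum_i luc_val (x i).
Proof. by elim/big_rec2 : _ => // i y z _ <-. Qed.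

(* An algebraic tensor is a functional on bilinear forms; evaluated at these
   forms it gives the values of its image in LUC(A'). *)
Definition act_bilin (x : A) : bilin (dual A) A.
Proof.
exists (fun f a => dual_act f a x) => [a|f] c y z.
  by rewrite dual_act_linl.
by rewrite dual_act_linr.
Defined.

(** The first clause determines phi from u alone, whatever representation of u is used; hence it can
    be applied to differences of tensors. *)
Lemma tensor_luc u : alg_tensor u -> exists phi : luc A,
  (forall x, luc_val phi x = u (act_bilin x)) /\
  (forall (T : cbmod A) (mu : dual (luc A)),
    (forall f a, mu (luc_act f a) = T f a) -> u (cb_bilin T) = mu phi).
Proof.
move=> /alg_tensor_sum[n [f [a ->]]]; exists (\sum_i luc_act (f i) (a i)); split.
  by move=> x; rewrite luc_val_sum dual_sumE bilin_sumE.
move=> T mu muT; rewrite bilin_sumE functional_sum.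
by apply: eq_bigr => i _; rewrite muT.
Qed.

(** The map f (x) a |-> f . a contracts the projective norm: a factorization of u is carried to one
    of phi, and the action is jointly completely contractive. *)
Lemma vnorm_tensor_luc u (phi : luc A) (e : R) : alg_tensor u ->
  (forall x, luc_val phi x = u (act_bilin x)) ->
  proj_norm (const_mx u : 'M_1) < e -> vnorm phi < e.
Proof.
move=> tu phiu /(proj_norm_lt tu)[p [q [a [v [w [b [uE lte]]]]]]].
have phiE : luc_val phi = mxact a (mxkron (@dual_act R A) v w) b 0 0.
  apply/val_inj/funext => x; rewrite [LHS]phiu.
  rewrite -[RHS]/(dual_fun (mxact a _ b 0 0) x).
  have -> : u = mxact a (mxkron et v w) b 0 0 by rewrite -uE mxE.
  rewrite [in LHS]mxE [in RHS]mxE bilin_sumE dual_sumE; apply: eq_bigr => k _.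
  rewrite bilin_sumE dual_sumE; apply: eq_bigr => l _.
  by rewrite [in LHS]mxE [in RHS]mxE.
rewrite vnorm_luc phiE -mxnormE1; apply: le_lt_trans lte.
apply: le_trans (mxnorm_act _ _ _) _; rewrite ler_wpM2r ?opnorm_ge0//.
by rewrite -mulrA ler_wpM2l ?opnorm_ge0// mxnorm_dual_act.
Qed.

(** Images of a Cauchy sequence of tensors are Cauchy in LUC(A'), so pairing with u amounts to
    evaluating functionals at one vector, the same for all T. *)
Lemma ptensor_luc (u : ptensor (dual A) A) : exists phi : luc A,
  forall (T : cbmod A) (mu : dual (luc A)),
    (forall f a, mu (luc_act f a) = T f a) -> cb_pairing T u = mu phi.
Proof.
have /choice[phi phiP] n := tensor_luc (ptensor_tensor u n).
have [e /(ptensor_cauchy u)[N uN]|l phil] := @luc_cauchy_cvg R A phi.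
  exists N => m n Nm Nn; apply: vnorm_tensor_luc (uN m n Nm Nn).
    by apply: alg_tensorB; exact: ptensor_tensor.
  move=> x; have [hm _] := phiP m; have [hn _] := phiP n.
  by rewrite luc_valB -[LHS]/(luc_val (phi m) x - luc_val (phi n) x) hm hn.
exists l => T mu muT; apply: cb_pairingP.
have -> : (fun n => u n (cb_bilin T)) = (fun n => mu (phi n)).
  by apply/funext => n; have [_] := phiP n; apply.
exact: dual_eval_cvg.
Qed.

Variables (I : Type) (G : set_system I) (e : I -> A).
Context {FG : ProperFilter G}.
Hypothesis e_le1 : forall i, vnorm (e i) <= 1.
Hypothesis e_cvg : forall a, amul a (e i) @[i --> G] --> a.

Lemma luc_series (phi : luc A) : exists (f : nat -> luc A) (s : nat -> A),
  [/\ f 0%N = phi, forall n, vnorm (s n) <= 1,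
      forall n, f n.+1 = f n - luc_act (f n) (s n) &
      forall n, vnorm (f n) <= (vnorm phi + 1) * 2^-1 ^+ n].
Proof.
(* The choice function takes the current remainder and its index together, so that the sequence can
   be defined by recursion. *)
have /choice[s sP] (p : luc A * nat) : exists a : A,
    vnorm a <= 1 /\ vnorm (p.1 - luc_act p.1 a) < 2^-1 ^+ p.2.
  have h0 : 0 < (2^-1 : R) ^+ p.2 by rewrite exprn_gt0// invr_gt0.
  have fe : luc_act p.1 (e i) @[i --> G] --> p.1 by exact: luc_act_approx.
  have /vnorm_cvgP/(_ _ h0)/filter_ex[i hi] := fe.
  by exists (e i); split; [exact: e_le1|exact: hi].
(* The index passed is m.+1, giving |f_{m+1}| < 2^-(m+1). At 0 nothing has been approximated, whence
   the constant |phi| + 1 in the bound. *)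
pose f := fix f n := if n is m.+1 then f m - luc_act (f m) (s (f m, m.+1)) else phi.
exists f, (fun n => s (f n, n.+1)); split => // [n|[|n]].
- by have [] := sP (f n, n.+1).
- by rewrite expr0 mulr1 lerDl.
have [_ /ltW h] := sP (f n, n.+1); apply: le_trans h _.
by rewrite ler_peMl ?exprn_ge0 ?invr_ge0// lerDr vnorm_ge0.
Qed.

(** The point u is the series of f_k (x) s_k, which converges absolutely by [luc_series]. *)
Lemma luc_ptensor (phi : luc A) : exists u : ptensor (dual A) A,
  forall (T : cbmod A) (mu : dual (luc A)),
    (forall f a, mu (luc_act f a) = T f a) -> cb_pairing T u = mu phi.
Proof.
have [f [s [f0 s1 fS fle]]] := luc_series phi.
set c := vnorm phi + 1 in fle; have c0 : 0 <= c by rewrite addr_ge0 ?vnorm_ge0.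
pose t n : bilin (dual A) A -> R[i]^o := \sum_(k < n) et (f k) (s k).
have tt n : alg_tensor (t n).
  by exists n, (fun=> 1), (fun k : 'I_n => et (f k) (s k)); split=> [k|];
    [exists (luc_val (f k)) => //; exists (s k)|apply: eq_bigr => k _; rewrite scale1r].
(* The unimodular factor z lets one estimate cover both signs of the difference. *)
have tail (z : R[i]) m n : normc z = 1 -> (m <= n)%N ->
    proj_norm (const_mx (z *: (t n - t m)) : 'M_1) <= c * 2 * 2^-1 ^+ m.
  move=> z1 /subnKC <-; set d := (n - m)%N.
  have -> : z *: (t (m + d)%N - t m) =
      \sum_(k < d) et (z *: luc_val (f (m + k)%N)) (s (m + k)%N).
    rewrite /t big_split_ord/= [X in z *: X]addrC addKr scaler_sumr.
    by apply: eq_bigr => k _; rewrite elem_tensorZl.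
  apply: le_trans (proj_norm_sum _ _) _.
  apply: (@le_trans _ _ (\sum_(k < d) c * 2^-1 ^+ (m + k))).
    apply: ler_sum => k _; rewrite vnormZ z1 mul1r -[leRHS]mulr1.
    by apply: ler_pM; rewrite ?vnorm_ge0 -?vnorm_luc.
  have -> : \sum_(k < d) c * 2^-1 ^+ (m + k) =
      c * 2 * (2^-1 ^+ m - 2^-1 ^+ (m + d)).
    elim: d => [|d IH]; first by rewrite big_ord0 addn0 subrr mulr0.
    by rewrite big_ord_recr/= IH addnS exprS; field.
  by rewrite ler_wpM2l ?mulr_ge0// gerBl exprn_ge0 ?invr_ge0.
have tC (d : R) : 0 < d -> exists N, forall m n, (N <= m)%N -> (N <= n)%N ->
    proj_norm (const_mx (t m - t n) : 'M_1) < d.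
  move=> d0; have [|N NP] := @geometric_small R (c * 2) d _ d0.
    by rewrite mulr_ge0.
  exists N => m n Nm Nn; case: (leqP n m) => [nm|/ltnW mn].
    apply: le_lt_trans (NP _ Nn); rewrite -[t m - t n]scale1r.
    by apply: tail => //; rewrite normc1.
  apply: le_lt_trans (NP _ Nm); rewrite -[t m - t n]opprB -scaleN1r.
  by apply: tail => //; rewrite normcN normc1.
exists (PTensor tt tC) => T mu muT; apply: cb_pairingP => /=.
(* The sum telescopes, since f_k . s_k = f_k - f_{k+1}. *)
have tE n : t n (cb_bilin T) = mu phi - mu (f n).
  rewrite /t bilin_sumE; elim: n => [|n IH]; first by rewrite big_ord0 f0 subrr.
  by rewrite big_ord_recr/= IH fS dual_linB muT opprB addrCA addrC addrA.
apply/(@vnorm_cvgP R R[i]^o) => d d0.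
have [|N NP] := @geometric_small R (vnorm mu * c) d _ d0.
  by rewrite mulr_ge0 ?vnorm_ge0.
exists N => // n /= Nn; rewrite tE opprB addrCA subrr addr0 vnormC.
apply: le_lt_trans (NP _ Nn); apply: le_trans (dual_normP _ _) _.
by rewrite -mulrA ler_wpM2l ?vnorm_ge0.
Qed.

End LucTensors.

(** * Weak* topologies *)

Lemma ptws_eval_continuous (I : Type) (T : topologicalType) (i : I) :
  continuous (fun f : {ptws I -> T} => f i).
Proof.
move=> f; have /cvg_sup/(_ i) h : f --> f by exact: cvg_id.
exact: cvg_comp h (@initial_continuous _ _ (fun f : I -> T => f i) f).
Qed.

Lemma ptws_continuous (X T : topologicalType) (I : Type) (F : X -> {ptws I -> T}) :
  (forall i, continuous (fun x => F x i)) -> continuous F.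
Proof.
move=> cF x; apply/cvg_sup => i.
exact: (@continuous_comp_initial _ _ _ (fun f : I -> T => f i) F (cF i) x).
Qed.

Section WeakStarContinuity.
Variables (R : realType) (A : ccBanachAlgType R).

Lemma cb_pairing_continuous (V W : operatorSpaceType R) (u : ptensor V W) :
  continuous (fun T : wstar_cb V W => cb_pairing T u : R[i]^o).
Proof.
move=> T; exact: (@continuous_comp (wstar_cb V W) {ptws ptensor V W -> R[i]^o} R[i]^o
  (@cb_pairing R V W) (fun f => f u) T
  (@initial_continuous _ _ (@cb_pairing R V W) T) (@ptws_eval_continuous _ _ u _)).
Qed.

Lemma cbmod_pairing_continuous (u : ptensor (dual A) A) :
  continuous (fun T : wstar_cbmod A => cb_pairing (cbmod_val T) u : R[i]^o).
Proof.
move=> T; exact: (@continuous_comp (wstar_cbmod A) (wstar_cb (dual A) A) R[i]^o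
  (@cbmod_val R A) (fun S => cb_pairing S u) T
  (@initial_continuous _ _ (fun T : cbmod A => cbmod_val T : wstar_cb (dual A) A) T)
  (@cb_pairing_continuous _ _ u _)).
Qed.

Lemma dual_pairing_continuous (V : operatorSpaceType R) (v : V) :
  continuous (fun f : wstar_dual V => dual_pairing f v : R[i]^o).
Proof.
move=> f; exact: (@continuous_comp (wstar_dual V) {ptws V -> R[i]^o} R[i]^o
  (@dual_pairing R V) (fun g => g v) f
  (@initial_continuous _ _ (@dual_pairing R V) f) (@ptws_eval_continuous _ _ v _)).
Qed.

(** The module identity is the family of conditions <T(f . a), b> - <T f, ab> = 0, and each left
    side is a difference of two weak* continuous pairings with elementary tensors. *)
Lemma cbmod_wstar_closed :
  @closed (wstar_cb (dual A) A) [set T | T \in @cbmod_pred R A].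
Proof.
have -> : [set T | T \in @cbmod_pred R A] =
    \bigcap_(p : dual A * A * A)
      [set T : wstar_cb (dual A) A |
        cb_pairing T (elem_ptensor (dual_act p.1.1 p.1.2) p.2) -
        cb_pairing T (elem_ptensor p.1.1 (amul p.1.2 p.2)) = 0].
  apply/seteqP; split=> T /=.
    move=> /asboolP hT [[f a] b] _ /=.
    by rewrite !cb_pairing_elem hT subrr.
  move=> hT; apply/asboolP => f a; apply/val_inj/funext => b.
  have := hT (f, a, b) I; rewrite /= !cb_pairing_elem => /eqP.
  by rewrite subr_eq0 => /eqP.
apply: closed_bigI => p _.
apply: (@preimage_closed _ _ (fun T : wstar_cb (dual A) A =>
    (cb_pairing T (elem_ptensor (dual_act p.1.1 p.1.2) p.2) -
     cb_pairing T (elem_ptensor p.1.1 (amul p.1.2 p.2)) : R[i]^o)) [set 0]).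
  move=> T _; exact: (cvgB
    (@cb_pairing_continuous _ _ (elem_ptensor (dual_act p.1.1 p.1.2) p.2) T)
    (@cb_pairing_continuous _ _ (elem_ptensor p.1.1 (amul p.1.2 p.2)) T)).
exact: (@accessible_closed_set1 R[i]^o (hausdorff_accessible (@norm_hausdorff _ _))).
Qed.

End WeakStarContinuity.

(** * The net as a filter, and the isomorphism *)

Lemma tail_filter_proper (I : Type) (le : I -> I -> Prop) :
  directed_rel le -> ProperFilter (tail_filter le).
Proof.
move=> [[i0] lexx le_trans dir]; split.
  by move=> [i /(_ i (lexx i))].
split; first by exists i0.
  move=> P Q [i iP] [j jQ]; have [k ik jk] := dir i j; exists k => l kl.
  by split; [exact: iP (le_trans _ _ _ ik kl)|exact: jQ (le_trans _ _ _ jk kl)].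
by move=> P Q PQ [i iP]; exists i => j /iP/PQ.
Qed.

Theorem theorem5p5 (R : realType) (A : ccBanachAlgType R)
    (hA : has_contractive_right_approx_id A) :
  [/\ cc_banach_algebra (@luc_dual_mul R A),
      GRing.submod_closed (@cbmod_pred R A),
      (forall S T : cbmap (dual A) (dual A),
         S \in @cbmod_pred R A -> T \in @cbmod_pred R A ->
         cb_comp S T \in @cbmod_pred R A),
      @closed (wstar_cb (dual A) A) [set T | T \in @cbmod_pred R A] &
      exists (Phi : cbmod A -> dual (luc A)) (Psi : dual (luc A) -> cbmod A),
      [/\ (forall (T : cbmod A) (mu : dual (luc A)),
             mu = Phi T <->
             forall (f : dual A) (a : A), mu (luc_act f a) = T f a),
          linear Phi,
          (forall S T : cbmod A,
             Phi (cbmod_comp S T) = luc_dual_mul (Phi S) (Phi T)),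
          complete_isometry Phi &
          [/\ cancel Phi Psi, cancel Psi Phi,
              continuous (Phi : wstar_cbmod A -> wstar_dual (luc A)) &
              continuous (Psi : wstar_dual (luc A) -> wstar_cbmod A)]]].
Proof.
have [I [le [e [/tail_filter_proper FG e_le1 e_cvg]]]] := hA.
have {}e_le1 i : vnorm (e i) <= 1.
  by have := e_le1 i; rewrite vnormE -(rmorph1 (real_complex R)) lecR.
have [Phi PhiP] := choice (cbmod_functional e_le1 e_cvg).
have PhiE T f a : Phi T (luc_act f a) = T f a.
  exact: cbmod_functional_act (PhiP T) f a.
(* Linearity, multiplicativity and the inverse law below reduce through this to checks on the
   generators f . a. *)
have PhiU (T : cbmod A) (mu : dual (luc A)) :
    mu = Phi T <-> forall f a, mu (luc_act f a) = T f a.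
  split=> [->|muT]; first exact: PhiE.
  by apply: luc_dual_ext => f a; rewrite muT PhiE.
have PsiE (mu : dual (luc A)) f a : mu (luc_act f a) = luc_dual_cbmod mu f a by [].
split.
- split; [exact: dual_complete|exact: luc_dual_mulA|exact: luc_dual_mul_linl
    |exact: luc_dual_mul_linr|exact: mxnorm_luc_dual_mul].
- split; first by apply/asboolP => f a; apply/val_inj/funext.
  by move=> c S T hS hT; rewrite rpredD ?rpredZ.
- exact: cbmod_comp_pred.
- exact: cbmod_wstar_closed.
exists Phi, (@luc_dual_cbmod R A); split.
- exact: PhiU.
- move=> c S T; apply/esym/PhiU => f a.
  exact: (congr2 (fun x y : R[i]^o => c *: x + y) (PhiE S f a) (PhiE T f a)).
- move=> S T; apply/esym/PhiU => f a.
  (* The product evaluates [Phi S] at [Phi T] [] (f . a), and that vector is (T f) . a. *)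
  rewrite -[RHS]/(S (T f) a) -PhiE; congr (Phi S _).
  apply/val_inj/val_inj/funext => b /=.
  by rewrite -PhiE; congr (Phi T _); apply/val_inj; exact: dual_actA.
- move=> n T; apply/eqP; rewrite eq_le; apply/andP; split.
    apply: (@mxnorm_cbmod_functional _ _ _ _ _ FG e_le1) => p q f.
    by rewrite mxE; exact: PhiP.
  by apply: mxnorm_cbmod_le => p q f a; rewrite mxE PhiE.
split.
- move=> T; apply/val_inj/val_inj/funext => f; apply/val_inj/funext => a.
  exact: PhiE.
- by move=> mu; apply/esym/PhiU.
(* It suffices to test at each phi, where [Phi T] is the pairing of T with a fixed u. *)
- apply: continuous_comp_initial; apply: ptws_continuous => phi.
  have [u uP] := luc_ptensor e_le1 e_cvg phi.
  rewrite (_ : (fun T => _) = fun T : wstar_cbmod A => cb_pairing (cbmod_val T) u).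
    exact: cbmod_pairing_continuous.
  by apply/funext => T; rewrite (uP T (Phi T) (PhiE T)).
(* Two initial topologies are nested here, that of the subspace and that of the pairing; each u is
   then replaced by its image phi. *)
- apply: continuous_comp_initial; apply: continuous_comp_initial.
  apply: ptws_continuous => u; have [phi phiP] := ptensor_luc u.
  rewrite (_ : (fun mu => _) = fun mu : wstar_dual (luc A) => dual_pairing mu phi).
    exact: dual_pairing_continuous.
  by apply/funext => mu; rewrite /= (phiP _ mu (PsiE mu)).
Qed.
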